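(* Let $\kappa>0$, let $x_0\approx0.83356$ be the unique positive solution of $x\operatorname{artanh}(x)=1$, and let $a\in\mathbb{R}$ satisfy $|a|<\sqrt{\frac{1-x_0^2}{x_0^2\kappa}}$ (i.e. the family $\mathcal{T}_a=\{T_a(H):H>0\}$ of tubes of pitch $a$ in $\mathbb{S}^2(\kappa)\times\mathbb{R}$ does not produce a foliation). Then the tube height $h_a^{\max}(H)$ attains its maximum over $H\in(0,\infty)$ at $$H=\frac{\sqrt\kappa}{2}\sqrt{\frac{1-x_0^2(1+\kappa a^2)}{x_0^2(1+\kappa a^2)}},$$ and the subfamily of tubes $$\hat{\mathcal{T}}_a:=\left\{T_a(H):H\in\left(\frac{\sqrt\kappa}{2}\sqrt{\frac{1-x_0^2(1+\kappa a^2)}{x_0^2(1+\kappa a^2)}},\ \infty\right)\right\}$$ foliates an open subset of $\mathbb{S}^2(\kappa)\times\mathbb{R}$.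
   Context: Coordinates: on $\mathbb{S}^2(\kappa)\times\mathbb{R}$ (with $\mathbb{S}^2(\kappa)$ the round sphere of curvature $\kappa>0$), away from the two fibers over the poles of $\mathbb{S}^2(\kappa)$, use $(r,\theta,z)\in(0,\pi/\sqrt\kappa)\times\mathbb{R}/2\pi\mathbb{Z}\times\mathbb{R}$ with metric $dr^2+\mathrm{sn}_\kappa^2(r)\,d\theta^2+dz^2$, where $\mathrm{sn}_\kappa(r)=\frac{1}{\sqrt\kappa}\sin(\sqrt\kappa\,r)$ and $\mathrm{cs}_\kappa(r)=\cos(\sqrt\kappa\,r)$. The screw motion group of pitch $a$ is $G_a=\{(r,\theta,z)\mapsto(r,\theta+s,z+as): s\in\mathbb{R}\}$. Tubes: for $H>0$ put $J=-2H/\kappa$. For $\sigma\in\mathbb{R}$ let $r(\sigma)\in(0,\pi/\sqrt\kappa)$ be the unique solution of $\frac{2H}{\kappa}(\mathrm{cs}_\kappa(r)-1)+\mathrm{sn}_\kappa(r)\sin\sigma=J$, and let $$h_a(\sigma)=\int_{\pi/2}^{\sigma}\frac{\sqrt{\mathrm{sn}_\kappa^2(r(u))+a^2}}{2H\,\mathrm{sn}_\kappa(r(u))-\mathrm{cs}_\kappa(r(u))\sin u}\,\sin u\,du .$$ The curve $\sigma\mapsto(r(\sigma),h_a(\sigma))$ is a simple closed curve (period $2\pi$) in the orbit space with coordinates $(r,h)$, and the tube $T_a(H)$ is the surface $\{(r(\sigma),s,h_a(\sigma)+as):\sigma,s\in\mathbb{R}\}$, which is $G_a$-invariant and has constant mean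 curvature $H$. The tube height is $h_a^{\max}(H):=h_a(\pi)$ (the maximum of $h_a$). A family of surfaces ''produces a foliation'' (or foliates an open subset) if its members are embedded, pairwise disjoint leaves of a foliation of an open subset of the ambient space.
   Formalization: As θ is mod 2π, the tubes can meet for small a≠0 (e.g. κ=1, a=0.1), so the foliation of an open subset of S²(κ)×R is stated to hold iff a=0 or the maximal tube height is at most π|a|; for all admissible a it is stated on the universal cover (θ in R) of the complement of the polar fibers. *)

(* Defs.v *)
From HB Require Import structures.
From mathcomp Require Import all_boot all_order all_algebra.
From mathcomp Require Import all_classical all_reals all_analysis.
Set Implicit Arguments.
Unset Strict Implicit.
Unset Printing Implicit Defensive.
Import Order.TTheory GRing.Theory Num.Theory.
Import numFieldNormedType.Exports.
Local Open Scope classical_set_scope.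
Local Open Scope ring_scope.

(* On ]-1, 1[ only; both ln and ^-1 take default values elsewhere. *)
Definition artanh (R : realType) (x : R) : R := ln ((1 + x) / (1 - x)) / 2.

Definition oriented_integral (R : realType) (f : R -> R) (a b : R) : R :=
  if a <= b then Rintegral lebesgue_measure `[a, b] f
  else - Rintegral lebesgue_measure `[b, a] f.

Section Foliations.
Variable R : realType.

(* f is of class C^k on the open set D: the iterated partial derivatives of
   order at most k exist and are continuous on D. *)
Fixpoint class_C (k m : nat) (D : set 'rV[R]_m) (f : 'rV[R]_m -> R) : Prop :=
  (forall x, D x -> {for x, continuous f}) /\
  match k with
  | 0 => True
  | k'.+1 => forall i : 'I_m,
      (forall x, D x -> derivable f x (delta_mx 0 i)) /\
      class_C k' D (fun x => 'D_(delta_mx 0 i) f x)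
  end.

Definition smooth_on (m n : nat) (D : set 'rV[R]_m)
    (f : 'rV[R]_m -> 'rV[R]_n) : Prop :=
  forall (j : 'I_n) (k : nat), class_C k D (fun x => f x 0 j).

Definition relatively_open (n : nat) (X U : set 'rV[R]_n) : Prop :=
  exists2 O : set 'rV[R]_n, open O & U = X `&` O.

Definition cube : set 'rV[R]_3 := [set x | forall i, `|x 0 i| < 1].

(* psi is a smooth regular parametrization of a relatively open part of X by
   the cube. As psi is continuous and injective, the last condition says that
   it is a homeomorphism onto a relatively open subset of X. Applied to a
   3-dimensional submanifold X of R^n, these are the inverses of the charts of
   X with image the cube. *)
Definition parametrization (n : nat) (X : set 'rV[R]_n)
    (psi : 'rV[R]_3 -> 'rV[R]_n) : Prop :=
  [/\ smooth_on cube psi,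
      forall x, cube x -> row_free (jacobian psi x),
      set_inj cube psi &
      forall D : set 'rV[R]_3, open D -> D `<=` cube ->
        relatively_open X (psi @` D)].

Definition plaque (n : nat) (psi : 'rV[R]_3 -> 'rV[R]_n) (t : R) :
    set 'rV[R]_n :=
  psi @` [set x | cube x /\ x 0 ord_max = t].

Definition embedded_surface (n : nat) (X S : set 'rV[R]_n) : Prop :=
  S `<=` X /\
  forall p, S p -> exists psi : 'rV[R]_3 -> 'rV[R]_n,
    [/\ parametrization X psi, (psi @` cube) p &
        S `&` (psi @` cube) = plaque psi 0].

(* The members L i (i in I) of the family are embedded, pairwise disjoint, and
   are the leaves of a smooth foliation of an open subset of the 3-dimensional
   submanifold X of R^n, which is then their union. A leaf may meet the domain
   of a foliated chart in several plaques, but only countably many. *)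
Definition foliates_open_subset (n : nat) (X : set 'rV[R]_n) (T : Type)
    (I : set T) (L : T -> set 'rV[R]_n) : Prop :=
  let U := \bigcup_(i in I) L i in
  [/\ relatively_open X U,
      trivIset I L,
      forall i, I i -> [/\ L i !=set0, connected (L i) &
                           embedded_surface X (L i)] &
      forall p, U p -> exists psi : 'rV[R]_3 -> 'rV[R]_n,
        [/\ parametrization X psi, (psi @` cube) p, psi @` cube `<=` U &
            forall i, I i -> exists2 C : set R, countable C &
              L i `&` (psi @` cube) = \bigcup_(t in C) plaque psi t]].

End Foliations.

Section Tubes.
Variables (R : realType) (kappa : R).

Definition sn (r : R) : R := sin (Num.sqrt kappa * r) / Num.sqrt kappa.
Definition cs (r : R) : R := cos (Num.sqrt kappa * r).

(* S^2(kappa) x R, with S^2(kappa) the sphere of radius 1 / sqrt kappa. *)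
Definition sphere_line : set 'rV[R]_4 :=
  [set p | p 0 (inord 0) ^+ 2 + p 0 (inord 1) ^+ 2 + p 0 (inord 2) ^+ 2
           = kappa^-1].

(* Coordinates (r, theta, z) with theta in R instead of R / 2 pi Z: the
   universal cover of the complement of the two fibers over the poles. *)
Definition universal_cover : set 'rV[R]_3 :=
  [set q | 0 < q 0 (inord 0) < pi / Num.sqrt kappa].

Definition point3 (r theta z : R) : 'rV[R]_3 :=
  \row_(i < 3) nth 0 [:: r; theta; z] i.

(* The covering map; it pulls the metric induced by R^4 back to
   dr^2 + sn(r)^2 dtheta^2 + dz^2. *)
Definition covering_map (q : 'rV[R]_3) : 'rV[R]_4 :=
  let r := q 0 (inord 0) in
  let theta := q 0 (inord 1) in
  let z := q 0 (inord 2) in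
  \row_(i < 4) nth 0 [:: sn r * cos theta; sn r * sin theta;
                         cs r / Num.sqrt kappa; z] i.

Definition tube_energy (H : R) : R := - (2 * H / kappa).

(* The unique solution r of the equation. *)
Definition tube_radius (H sigma : R) : R :=
  get [set r | 0 < r < pi / Num.sqrt kappa /\
         2 * H / kappa * (cs r - 1) + sn r * sin sigma = tube_energy H].

Definition tube_h (a H sigma : R) : R :=
  oriented_integral (fun u =>
      Num.sqrt (sn (tube_radius H u) ^+ 2 + a ^+ 2)
      / (2 * H * sn (tube_radius H u) - cs (tube_radius H u) * sin u)
      * sin u)
    (pi / 2) sigma.

Definition tube_height (a H : R) : R := tube_h a H pi.

(* On the universal cover the orbit-space coordinate h = z - a theta is well
   defined; in S^2(kappa) x R it is so only modulo 2 pi a, and the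
   tube is embedded there only if, for a <> 0, the generating curve is disjoint
   from its translates by 2 pi a in the h-direction. *)
Definition lifted_tube (a H : R) : set 'rV[R]_3 :=
  [set q | exists sigma s,
     q = point3 (tube_radius H sigma) s (tube_h a H sigma + a * s)].

Definition tube (a H : R) : set 'rV[R]_4 := covering_map @` lifted_tube a H.

(* The value of H at which the tube height of pitch a is maximal. *)
Definition critical_H (x0 a : R) : R :=
  Num.sqrt kappa / 2 *
  Num.sqrt ((1 - x0 ^+ 2 * (1 + kappa * a ^+ 2))
            / (x0 ^+ 2 * (1 + kappa * a ^+ 2))).

End Tubes.

(* Main.v *)
Require Import Defs.
From HB Require Import structures.
From mathcomp Require Import all_boot all_order all_algebra.
From mathcomp Require Import all_classical all_reals all_analysis.
From mathcomp Require Import ring lra.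
Import Order.TTheory GRing.Theory Num.Theory.
Import numFieldNormedType.Exports.
Local Open Scope classical_set_scope.
Local Open Scope ring_scope.
Set Implicit Arguments.
Unset Strict Implicit.
Unset Printing Implicit Defensive.

(** Put [k = sqrt kappa], [b = k a] and [mu = k / (2 H)]. The tube equation reads
    [- cot (k r) = mu sin sigma]; with [p = - cot (k r)] and
    [t = - mu cos sigma] the generating curve becomes the circle
    [p^2 + t^2 = mu^2], and the integral defining [h_a] has the closed form
    [k h_a = profile b p t] with
    [profile b p t = b atan (b t / S) + artanh q / C], [q = t / (C S)],
    [C = sqrt (1 + p^2 + t^2)], [S = sqrt (1 + b^2 (1 + p^2))].
    For fixed [p] its [t]-derivative is [S / C^2 (1 - q artanh q)], positive
    exactly when [|q| < x0], and [|q| < x0] on the open disc of radius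
    [M = k / (2 H0)]. Taking [p = 0] gives the maximality of the height; in
    general, [(p, t) |-> (p, profile b p t)] embeds the punctured disc, and polar
    coordinates in it give foliated charts whose plaques are pieces of tubes.
    The deck transformation [theta |-> theta + 2 pi] shifts [h] by [- 2 pi a],
    so downstairs the tubes stay disjoint iff [a = 0] or the image of the disc,
    whose extent in the direction of [h] is twice the height at [H0], is disjoint
    from its translates. *)

(** * Elementary functions are smooth *)

(** Differentiability is local: the first-order expansion of [f] at [x] serves for [g] as well. This
    is what lets [elementary_ext] ask for equality on [D] only. *)
Lemma near_eq_differentiable (R : numFieldType) (V W : normedModType R)
    (f g : V -> W) (x : V) :
  (\forall y \near x, f y = g y) -> differentiable f x -> differentiable g x.
Proof.
move=> fg /diff_locallyP[dc de].
have gE : g \o shift x = cst (g x) + 'd f x +o_ 0 id.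
  have /eqaddoP fE := de; apply/eqaddoP => e e0.
  have := fE e e0; apply: filter_app.
  have fg0 : \forall h \near (0 : V), f (h + x) = g (h + x).
    have := fg; rewrite (near_shift 0 x)/=; apply: filterS => h.
    by rewrite /shift/= subr0.
  near=> h; have fgh : f (h + x) = g (h + x) by near: h.
  by rewrite !fctE /= /shift /= fgh (nbhs_singleton fg).
by apply/diff_locallyP; rewrite (diff_unique dc gE).
Unshelve. all: by end_near. Qed.

Section Elementary.
Context {R : realType} {m : nat}.
Implicit Types (D : set 'rV[R]_m) (f g : 'rV[R]_m -> R) (x v : 'rV[R]_m).

(** A syntactic class stable under differentiation, with side conditions on [D] that keep inverses,
    roots and logarithms away from their default values. Smoothness to every order then follows by
    induction, without computing a derivative of any concrete map. *)
Inductive elementary D : ('rV[R]_m -> R) -> Prop :=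
| elementary_cst c : elementary D (fun=> c)
| elementary_coord i : elementary D (fun x => x 0 i)
| elementaryD f g :
    elementary D f -> elementary D g -> elementary D (fun x => f x + g x)
| elementaryM f g :
    elementary D f -> elementary D g -> elementary D (fun x => f x * g x)
| elementaryV f : (forall x, D x -> f x != 0) ->
    elementary D f -> elementary D (fun x => (f x)^-1)
| elementary_sqrt f : (forall x, D x -> 0 < f x) ->
    elementary D f -> elementary D (fun x => Num.sqrt (f x))
| elementary_ln f : (forall x, D x -> 0 < f x) ->
    elementary D f -> elementary D (fun x => ln (f x))
| elementary_atan f : elementary D f -> elementary D (fun x => atan (f x))
| elementary_sin f : elementary D f -> elementary D (fun x => sin (f x))
| elementary_cos f : elementary D f -> elementary D (fun x => cos (f x))
| elementary_ext f g : (forall x, D x -> f x = g x) ->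
    elementary D f -> elementary D g.

Lemma elementaryS D E f :
  E `<=` D -> elementary D f -> elementary E f.
Proof.
move=> ED; elim=> {f}
  [c|i|f h _ ef _ eh|f h _ ef _ eh|f f0 _ ef|f f0 _ ef|f f0 _ ef|f _ ef
  |f _ ef|f _ ef|f h fh _ ef].
- exact: elementary_cst.
- exact: elementary_coord.
- exact: elementaryD.
- exact: elementaryM.
- by apply: elementaryV => // x /ED; exact: f0.
- by apply: elementary_sqrt => // x /ED; exact: f0.
- by apply: elementary_ln => // x /ED; exact: f0.
- exact: elementary_atan.
- exact: elementary_sin.
- exact: elementary_cos.
- by apply: elementary_ext ef => x /ED; exact: fh.
Qed.

Lemma elementaryN D f : elementary D f -> elementary D (fun x => - f x).
Proof.
move=> ef; apply: (@elementary_ext _ (fun x => (-1) * f x)) => [x _|].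
  by rewrite mulN1r.
by apply: elementaryM => //; exact: elementary_cst.
Qed.

Lemma elementaryB D f g :
  elementary D f -> elementary D g -> elementary D (fun x => f x - g x).
Proof. by move=> ef eg; apply: elementaryD => //; exact: elementaryN. Qed.

Lemma elementary_div D f g : (forall x, D x -> g x != 0) ->
  elementary D f -> elementary D g -> elementary D (fun x => f x / g x).
Proof. by move=> g0 ef eg; apply: elementaryM => //; exact: elementaryV. Qed.

Lemma elementaryX D f n : elementary D f -> elementary D (fun x => f x ^+ n).
Proof.
move=> ef; elim: n => [|n IH].
  by under eq_fun do rewrite expr0; exact: elementary_cst.
by under eq_fun do rewrite exprS; exact: elementaryM.
Qed.

Lemma elementary_artanh D f : (forall x, D x -> -1 < f x < 1) ->
  elementary D f -> elementary D (fun x => artanh (f x)).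
Proof.
move=> f1 ef.
apply: elementary_div => [x _||]; [exact: lt0r_neq0| |exact: elementary_cst].
apply: elementary_ln => [x /f1 /andP[x1 x2]|].
  by rewrite divr_gt0//; lra.
apply: elementary_div => [x /f1 /andP[x1 x2]||].
- by rewrite lt0r_neq0//; lra.
- by apply: elementaryD => //; exact: elementary_cst.
- by apply: elementaryB => //; exact: elementary_cst.
Qed.

Lemma differentiable_comp1 (h : R -> R) f x :
  derivable h (f x) 1 -> differentiable f x -> differentiable (fun y => h (f y)) x.
Proof. by move=> /derivable1_diffP dh df; exact: differentiable_comp df dh. Qed.

Lemma derive_comp1 (h : R -> R) dh f x v :
  is_derive (f x) 1 h dh -> differentiable f x ->
  'D_v (fun y => h (f y)) x = dh * 'D_v f x.
Proof.
move=> hh df; have dhf : differentiable h (f x) by apply/derivable1_diffP.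
rewrite deriveE; last exact: differentiable_comp.
rewrite (diff_comp df dhf)/= deriveE// deriv1E//=.
by rewrite derive1E derive_val mulrC.
Qed.

(* [elementary_ext] makes the derivative, known up to its values outside [D],
   elementary as it stands. *)
Lemma elementary_derive D f : open D -> elementary D f ->
  (forall x, D x -> differentiable f x) /\
  (forall v, elementary D (fun x => 'D_v f x)).
Proof.
move=> oD.
elim=> {f}
  [c|i|f g ef [df def] eg [dg deg]|f g ef [df def] eg [dg deg]
  |f f0 ef [df def]|f f0 ef [df def]|f f0 ef [df def]|f ef [df def]
  |f ef [df def]|f ef [df def]|f g fg ef [df def]].
- split=> [x _|v]; first exact: differentiable_cst.
  by under eq_fun do rewrite derive_cst; exact: elementary_cst.
- have dc x : differentiable (fun x : 'rV[R]_m => x 0 i : R) x.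
    exact: differentiable_coord.
  split=> // v; apply: (@elementary_ext _ (fun=> v 0 i)) => [x _|]; last first.
    exact: elementary_cst.
  have /derivable_mxP h : derivable (@id 'rV[R]_m) x v by exact: derivable_id.
  have := derive_mx (@derivable_id _ _ x v).
  by rewrite derive_id => /matrixP/(_ 0 i); rewrite mxE => ->.
- split=> [x Dx|v]; first by apply: differentiableD; [exact: df|exact: dg].
  apply: (@elementary_ext _ (fun x => 'D_v f x + 'D_v g x)) => [x Dx|].
    by rewrite -[RHS]/('D_v (f + g) x) deriveD//;
      apply: diff_derivable; [exact: df|exact: dg].
  exact: elementaryD.
- split=> [x Dx|v]; first by apply: differentiableM; [exact: df|exact: dg].
  apply: (@elementary_ext _ (fun x => f x * 'D_v g x + g x * 'D_v f x)) => [x Dx|].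
    by rewrite -[RHS]/('D_v (f * g) x) deriveM//;
      apply: diff_derivable; [exact: df|exact: dg].
  by apply: elementaryD; exact: elementaryM.
- split=> [x Dx|v]; first by apply: differentiableV; [exact: df|exact: f0].
  apply: (@elementary_ext _ (fun x => - (f x)^-1 ^+ 2 * 'D_v f x)) => [x Dx|].
    rewrite deriveV; [|exact: f0|apply: diff_derivable; exact: df].
    by rewrite exprVn.
  by apply: elementaryM => //; apply/elementaryN/elementaryX/elementaryV.
- have s0 x : D x -> 2 * Num.sqrt (f x) != 0.
    by move=> Dx; rewrite lt0r_neq0// mulr_gt0// sqrtr_gt0 f0.
  have dh x : D x -> is_derive (f x) 1 Num.sqrt (2 * Num.sqrt (f x))^-1.
    by move=> Dx; apply: is_derive1_sqrt; exact: f0.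
  split=> [x Dx|v].
    by have ? := dh _ Dx; apply: differentiable_comp1 => //; exact: df.
  apply: (@elementary_ext _ (fun x => (2 * Num.sqrt (f x))^-1 * 'D_v f x)) => [x Dx|].
    by have ? := dh _ Dx; rewrite derive_comp1//; exact: df.
  apply: elementaryM => //; apply: elementaryV => //.
  by apply: elementaryM; [exact: elementary_cst|exact: elementary_sqrt].
- have dh x : D x -> is_derive (f x) 1 (@ln R) (f x)^-1.
    by move=> Dx; apply: is_derive1_ln; exact: f0.
  split=> [x Dx|v].
    by have ? := dh _ Dx; apply: differentiable_comp1 => //; exact: df.
  apply: (@elementary_ext _ (fun x => (f x)^-1 * 'D_v f x)) => [x Dx|].
    by have ? := dh _ Dx; rewrite derive_comp1//; exact: df.
  by apply: elementaryM => //; apply: elementaryV => // x /f0 /lt0r_neq0.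
- split=> [x Dx|v]; first by apply: differentiable_comp1 => //; exact: df.
  apply: (@elementary_ext _ (fun x => (1 + f x ^+ 2)^-1 * 'D_v f x)) => [x Dx|].
    by rewrite derive_comp1//; exact: df.
  apply: elementaryM => //; apply: elementaryV.
    by move=> x _; rewrite lt0r_neq0// ltr_wpDr ?sqr_ge0.
  by apply: elementaryD; [exact: elementary_cst|exact: elementaryX].
- split=> [x Dx|v]; first by apply: differentiable_comp1 => //; exact: df.
  apply: (@elementary_ext _ (fun x => cos (f x) * 'D_v f x)) => [x Dx|].
    by rewrite derive_comp1//; exact: df.
  by apply: elementaryM => //; exact: elementary_cos.
- split=> [x Dx|v]; first by apply: differentiable_comp1 => //; exact: df.
  apply: (@elementary_ext _ (fun x => - sin (f x) * 'D_v f x)) => [x Dx|].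
    by rewrite derive_comp1//; exact: df.
  by apply: elementaryM => //; apply/elementaryN; exact: elementary_sin.
- have nfg x : D x -> \forall y \near x, f y = g y.
    by move=> Dx; have := open_nbhs_nbhs (conj oD Dx); apply: filterS => y /fg.
  split=> [x Dx|v].
    by apply: near_eq_differentiable (df _ Dx); exact: nfg.
  apply: (@elementary_ext _ (fun x => 'D_v f x)) => // x Dx.
  by apply: near_eq_derive; exact: nfg.
Qed.
End Elementary.

Section ElementaryMaps.
Context {R : realType}.

Lemma class_C_elementary m k (D : set 'rV[R]_m) (f : 'rV[R]_m -> R) :
  open D -> elementary D f -> class_C k D f.
Proof.
move=> oD; elim: k f => [|k IH] f ef;
  (have [df ef'] := elementary_derive oD ef; split;
    first by move=> x /df /differentiable_continuous) => //.
by move=> i; split=> [x /df Dx|]; [exact: diff_derivable|exact: IH].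
Qed.

Lemma differentiable_rV m n (f : 'rV[R]_m -> 'rV[R]_n) x :
  (forall j, differentiable (fun y => f y 0 j) x) -> differentiable f x.
Proof.
move=> df; have -> : f = \sum_(j < n) (fun y => f y 0 j *: 'e_j).
  by apply/funext => y; rewrite fct_sumE [LHS]row_sum_delta.
by apply: differentiable_sum => j; exact: differentiableZl.
Qed.

Definition elementary_map m n (D : set 'rV[R]_m) (f : 'rV[R]_m -> 'rV[R]_n) :=
  forall j, elementary D (fun x => f x 0 j).

Lemma elementary_map_smooth m n D (f : 'rV[R]_m -> 'rV[R]_n) :
  open D -> elementary_map D f -> smooth_on D f.
Proof. by move=> oD ef j k; exact: class_C_elementary. Qed.

Lemma elementary_map_differentiable m n D (f : 'rV[R]_m -> 'rV[R]_n) x :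
  open D -> elementary_map D f -> D x -> differentiable f x.
Proof.
move=> oD ef Dx; apply: differentiable_rV => j.
by have [+ _] := elementary_derive oD (ef j); exact.
Qed.

Lemma elementary_map_continuous m n D (f : 'rV[R]_m -> 'rV[R]_n) x :
  open D -> elementary_map D f -> D x -> {for x, continuous f}.
Proof.
move=> oD ef Dx; apply: differentiable_continuous.
exact: elementary_map_differentiable ef Dx.
Qed.

Lemma elementary_preimage_open m n D (f : 'rV[R]_m -> 'rV[R]_n) V :
  open D -> elementary_map D f -> open V -> open (D `&` f @^-1` V).
Proof.
rewrite !openE => oD ef oV x [Dx Vfx].
apply: filterI; first exact: oD.
apply: (elementary_map_continuous _ ef Dx); first by rewrite openE.
exact: oV.
Qed.

(** With row vectors the differential is right multiplication by the Jacobian, so ['d f x] kills the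
    rows of the left kernel matrix. *)
Lemma row_free_jacobian m n (f : 'rV[R]_m -> 'rV[R]_n) x :
  differentiable f x -> (forall v, 'd f x v = 0 -> v = 0) ->
  row_free (jacobian f x).
Proof.
move=> df inj; rewrite -kermx_eq0; apply/eqP/row_matrixP => i; rewrite row0.
apply: inj; rewrite -deriveE// deriveEjacobian// -row_mul mulmx_ker.
by rewrite row0.
Qed.

Lemma derive_rV m n (f : 'rV[R]_m -> 'rV[R]_n) x v j :
  differentiable f x -> 'D_v (fun y => f y 0 j) x = 'd f x v 0 j.
Proof.
move=> df; rewrite -deriveE// derive_mx; last exact: diff_derivable.
by rewrite mxE.
Qed.

End ElementaryMaps.

(** * The closed form of the height *)

Section RealDerivatives.
Context {R : realType}.
Implicit Types (f g : R -> R) (s df dg : R).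

Lemma is_deriveD_fun f g s df dg : is_derive s 1 f df -> is_derive s 1 g dg ->
  is_derive s 1 (fun s => f s + g s) (df + dg).
Proof. exact: is_deriveD. Qed.

Lemma is_deriveM_fun f g s df dg : is_derive s 1 f df -> is_derive s 1 g dg ->
  is_derive s 1 (fun s => f s * g s) (df * g s + f s * dg).
Proof.
move=> hf hg; apply: (is_derive_eq (is_deriveM hf hg)).
by rewrite addrC [g s *: _]mulrC.
Qed.

Lemma is_derive_div f g s df dg :
  is_derive s 1 f df -> is_derive s 1 g dg -> g s != 0 ->
  is_derive s 1 (fun s => f s / g s) ((df * g s - f s * dg) / g s ^+ 2).
Proof.
move=> hf hg g0; have hgV := is_deriveV g0 hg.
apply: (is_derive_eq (is_deriveM_fun hf hgV)).
by rewrite /GRing.scale/=; field.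
Qed.

Lemma is_derive_comp (h : R -> R) f s dh df : is_derive s 1 f df ->
  is_derive (f s) 1 h dh -> is_derive s 1 (fun s => h (f s)) (dh * df).
Proof. by move=> hf hh; exact: is_derive1_comp. Qed.

Lemma is_derive_sqr f s df : is_derive s 1 f df ->
  is_derive s 1 (fun s => f s ^+ 2) (2 * f s * df).
Proof.
move=> hf; apply: (is_derive_eq (is_deriveM_fun hf hf)).
by ring.
Qed.

Lemma is_derive_artanh (x : R) : -1 < x < 1 ->
  is_derive x 1 (@artanh R) (1 - x ^+ 2)^-1.
Proof.
move=> /andP[x1 x2].
have d1 : is_derive x 1 (fun x : R => 1 + x) 1.
  by apply: (is_derive_eq (is_deriveD_fun (is_derive_cst _ _ _) (is_derive_id _ _)));
    rewrite add0r.
have d2 : is_derive x 1 (fun x : R => 1 - x) (-1).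
  by apply: (is_derive_eq (is_deriveD_fun (is_derive_cst _ _ _) (is_deriveNid _ _)));
    rewrite add0r.
have u2 : 1 - x != 0 by lra.
have d3 := is_derive_div d1 d2 u2.
have d4 : is_derive ((1 + x) / (1 - x)) 1 (@ln R) ((1 + x) / (1 - x))^-1.
  by apply: is_derive1_ln; rewrite divr_gt0//; lra.
have d5 := is_derive_comp d3 d4.
apply: (is_derive_eq (is_deriveM_fun d5 (is_derive_cst (2^-1 : R) x 1))).
rewrite /= mulr0 addr0; field; rewrite u2 /=; apply/andP; split; nra.
Qed.

Lemma artanh0 : artanh (0 : R) = 0.
Proof. by rewrite /artanh addr0 subr0 divr1 ln1 mul0r. Qed.

Lemma artanhN (x : R) : -1 < x < 1 -> artanh (- x) = - artanh x.
Proof.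
move=> /andP[x1 x2]; rewrite /artanh opprK.
rewrite -(invf_div (1 + x)) lnV ?mulNr// posrE divr_gt0//; lra.
Qed.

Lemma ltr_artanh : {in `]-1, 1[ &, {homo @artanh R : x y / x < y}}.
Proof.
move=> x y; rewrite !in_itv/= => /andP[x1 x2] /andP[y1 y2] xy.
rewrite /artanh ltr_pM2r// ltr_ln ?posrE ?divr_gt0//; try lra.
rewrite ltr_pdivrMr; last lra.
rewrite mulrAC ltr_pdivlMr; last lra.
by nra.
Qed.

Lemma artanh_ge0 (x : R) : 0 <= x < 1 -> 0 <= artanh x.
Proof.
move=> /andP[]; rewrite le_eqVlt => /predU1P[<- _|x0 x1].
  by rewrite artanh0.
by rewrite -artanh0 ltW// ltr_artanh// in_itv/=; lra.
Qed.

(** * The sign of 1 - x artanh x *)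

Section Root.
Variable x0 : R.
Hypotheses (x0_in01 : 0 < x0 < 1) (x0_root : x0 * artanh x0 = 1).

(** The function [x * artanh x] is even, and increasing on [0, 1) as a product of nonnegative
    increasing factors. *)
Lemma mul_artanh_lt1 (x : R) : `|x| < x0 -> x * artanh x < 1.
Proof.
have [x00 x01] := andP x0_in01.
wlog x_ge0 : x / 0 <= x.
  move=> wl; have [/wl//|x_lt0] := lerP 0 x.
  move=> xx; have := wl (- x); rewrite normrN artanhN ?mulrNN//.
    by apply; lra.
  by move: xx; rewrite ltr_norml; lra.
rewrite ger0_norm// => xx0.
have a0 := @artanh_ge0 x ltac:(lra).
have : artanh x < artanh x0 by apply: ltr_artanh => //; rewrite in_itv/=; lra.
by have := x0_root; nra.
Qed.

Lemma mul_artanh_gt1 (x : R) : x0 < x < 1 -> 1 < x * artanh x.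
Proof.
have [x00 x01] := andP x0_in01; move=> /andP[xx x1].
have a0 := @artanh_ge0 x0 ltac:(lra).
have : artanh x0 < artanh x by apply: ltr_artanh => //; rewrite in_itv/=; lra.
by have := x0_root; nra.
Qed.

End Root.
End RealDerivatives.

(** * The profile function and its derivative along curves *)

Section Profile.
Context {R : realType}.
Implicit Types (b p t : R).

Definition profile_arg b p t : R :=
  t / (Num.sqrt (1 + p ^+ 2 + t ^+ 2) * Num.sqrt (1 + b ^+ 2 * (1 + p ^+ 2))).

Definition profile b p t : R :=
  b * atan (b * t / Num.sqrt (1 + b ^+ 2 * (1 + p ^+ 2))) +
  artanh (profile_arg b p t) / Num.sqrt (1 + p ^+ 2 + t ^+ 2).

Lemma profile_C_gt0 p t : 0 < Num.sqrt (1 + p ^+ 2 + t ^+ 2) :> R.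
Proof. by rewrite sqrtr_gt0; have := sqr_ge0 p; have := sqr_ge0 t; lra. Qed.

Lemma profile_N_gt0 b p : 0 < 1 + b ^+ 2 * (1 + p ^+ 2) :> R.
Proof. by have := sqr_ge0 (b * p); have := sqr_ge0 b; nra. Qed.

Lemma profile_S_gt0 b p : 0 < Num.sqrt (1 + b ^+ 2 * (1 + p ^+ 2)) :> R.
Proof. by rewrite sqrtr_gt0 profile_N_gt0. Qed.

Lemma profile_arg_sqr b p t : profile_arg b p t ^+ 2 =
  t ^+ 2 / ((1 + p ^+ 2 + t ^+ 2) * (1 + b ^+ 2 * (1 + p ^+ 2))).
Proof.
rewrite /profile_arg expr_div_n exprMn !sqr_sqrtr//.
  exact: ltW (profile_N_gt0 _ _).
by have := sqr_ge0 p; have := sqr_ge0 t; lra.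
Qed.

(** Valid on the whole plane, so the [artanh] in [profile] never takes a default value. *)
Lemma profile_arg_bound b p t : -1 < profile_arg b p t < 1.
Proof.
rewrite -ltr_norml -(@ltr_pXn2r _ 2)// ?nnegrE//.
rewrite expr1n -normrX ger0_norm ?sqr_ge0// profile_arg_sqr.
have hp := sqr_ge0 p; have ht := sqr_ge0 t; have hb := sqr_ge0 b.
have hbp := mulr_ge0 hb hp; have hbt := mulr_ge0 hb ht.
by rewrite ltr_pdivrMr ?mul1r ?mulr_gt0 ?profile_N_gt0//; nra.
Qed.

(* [S] and [C] stand for [sqrt (1 + b^2 (1 + p^2))] and [sqrt (1 + p^2 + t^2)];
   everything collapses because [S^2 + b^2 t^2] and [(C^2 S^2 - t^2) / (1 + p^2)]
   are both [1 + b^2 C^2]. *)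
Lemma profile_derive_identity b p t dp dt S C L :
  S != 0 -> C != 0 -> S ^+ 2 = 1 + b ^+ 2 * (1 + p ^+ 2) ->
  C ^+ 2 = 1 + p ^+ 2 + t ^+ 2 ->
  let dS := (2 * S)^-1 * (b ^+ 2 * (2 * p * dp)) in
  let dC := (2 * C)^-1 * (2 * p * dp + 2 * t * dt) in
  b * ((1 + (b * t / S) ^+ 2)^-1 * ((b * dt * S - b * t * dS) / S ^+ 2)) +
  ((1 - (t / (C * S)) ^+ 2)^-1 *
     ((dt * (C * S) - t * (dC * S + C * dS)) / (C * S) ^+ 2) * C - L * dC) /
  C ^+ 2 =
  S / C ^+ 2 * (dt - t * p * dp / (1 + p ^+ 2)) -
  L / C ^+ 3 * (p * dp + t * dt).
Proof.
move=> S0 C0 hS hC dS dC.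
have hp := sqr_ge0 p; have ht := sqr_ge0 t; have hb := sqr_ge0 b.
have hbp := mulr_ge0 hb hp; have hbt := mulr_ge0 hb ht.
set P := 1 + p ^+ 2; set Q := 1 + b ^+ 2 * (P + t ^+ 2).
have P0 : P != 0 by rewrite /P; lra.
have Q0 : Q != 0 by rewrite /Q /P; nra.
have -> : 1 + (b * t / S) ^+ 2 = Q / S ^+ 2.
  rewrite expr_div_n -[1 in LHS](divff (expf_neq0 2 S0)) -mulrDl hS /Q /P.
  by congr (_ / _); ring.
have -> : 1 - (t / (C * S)) ^+ 2 = P * Q / (C * S) ^+ 2.
  rewrite expr_div_n -[1 in LHS](divff (expf_neq0 2 (mulf_neq0 C0 S0))) -mulrBl.
  by congr (_ / _); rewrite exprMn hS hC /Q /P; ring.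
(* The numerator is kept polynomial in S^2 and C^2, so that [hS] and [hC] can be substituted in it
   before [ring]. *)
transitivity ((b ^+ 2 * P * C ^+ 2 * (dt * S ^+ 2 - t * b ^+ 2 * p * dp) +
  (dt * C ^+ 2 * S ^+ 2 - t * (p * dp + t * dt) * S ^+ 2 -
   t * C ^+ 2 * b ^+ 2 * p * dp)) / (Q * P * C ^+ 2 * S) -
  L / C ^+ 3 * (p * dp + t * dt)).
  rewrite /dS /dC; move: P Q P0 Q0 => P Q P0 Q0.
  by field; rewrite S0 C0 P0 Q0.
congr (_ - _).
transitivity (S ^+ 2 * (dt * P - t * p * dp) * Q / (Q * P * C ^+ 2 * S)).
  by congr (_ / _); rewrite hS hC /Q /P; ring.
by move: P Q P0 Q0 => P Q P0 Q0; field; rewrite S0 C0 P0 Q0.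
Qed.

(** The [artanh] term is isolated with the factor p dp + t dt, half the derivative of p^2 + t^2, so
    it disappears along circles around the origin. *)
Lemma is_derive_profile b (p t : R -> R) (s dp dt : R) :
  is_derive s 1 p dp -> is_derive s 1 t dt ->
  let S := Num.sqrt (1 + b ^+ 2 * (1 + p s ^+ 2)) in
  let C := Num.sqrt (1 + p s ^+ 2 + t s ^+ 2) in
  is_derive s 1 (fun s => profile b (p s) (t s))
    (S / C ^+ 2 * (dt - t s * p s * dp / (1 + p s ^+ 2)) -
     artanh (profile_arg b (p s) (t s)) / C ^+ 3 * (p s * dp + t s * dt)).
Proof.
move=> hp ht S C.
have S0 : S != 0 by rewrite gt_eqF// profile_S_gt0.
have C0 : C != 0 by rewrite gt_eqF// profile_C_gt0.
have hcst (c : R) : is_derive s 1 (fun=> c) 0 by exact: is_derive_cst.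
have hP : is_derive s 1 (fun s => 1 + p s ^+ 2) (2 * p s * dp).
  have h := is_derive_sqr hp.
  by apply: (is_derive_eq (is_deriveD_fun (hcst 1) h)); rewrite add0r.
have hN : is_derive s 1 (fun s => 1 + b ^+ 2 * (1 + p s ^+ 2))
    (b ^+ 2 * (2 * p s * dp)).
  have h := is_deriveM_fun (hcst (b ^+ 2)) hP.
  by apply: (is_derive_eq (is_deriveD_fun (hcst 1) h)); rewrite add0r mul0r add0r.
have hC2 := is_deriveD_fun hP (is_derive_sqr ht).
have hS : is_derive s 1 (fun s => Num.sqrt (1 + b ^+ 2 * (1 + p s ^+ 2)))
    ((2 * S)^-1 * (b ^+ 2 * (2 * p s * dp))).
  by apply: (is_derive_comp hN); apply: is_derive1_sqrt; exact: profile_N_gt0.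
have hC : is_derive s 1 (fun s => Num.sqrt (1 + p s ^+ 2 + t s ^+ 2))
    ((2 * C)^-1 * (2 * p s * dp + 2 * t s * dt)).
  apply: (is_derive_comp hC2); apply: is_derive1_sqrt.
  by rewrite -sqrtr_gt0 profile_C_gt0.
have hCS := is_deriveM_fun hC hS.
have hq := is_derive_div ht hCS (mulf_neq0 C0 S0).
have hL := is_derive_comp hq (is_derive_artanh (profile_arg_bound b (p s) (t s))).
have hbt : is_derive s 1 (fun s => b * t s) (b * dt).
  by apply: (is_derive_eq (is_deriveM_fun (hcst b) ht)); rewrite mul0r add0r.
have hA := is_derive_comp (is_derive_div hbt hS S0) (is_derive1_atan _).
have hbA := is_deriveM_fun (hcst b) hA.
apply: (is_derive_eq (is_deriveD_fun hbA (is_derive_div hL hC C0))).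
rewrite mul0r add0r; apply: profile_derive_identity => //.
- by rewrite /S sqr_sqrtr// ltW// profile_N_gt0.
- by rewrite /C sqr_sqrtr// ltW// -sqrtr_gt0 profile_C_gt0.
Qed.

End Profile.

(** * Monotonicity and extrema of the profile *)

Section ProfileMonotonicity.
Context {R : realType}.
Implicit Types (b p t M mu : R).

Lemma profile0 b p : profile b p 0 = 0.
Proof.
rewrite /profile /profile_arg mulr0 !mul0r atan0 artanh0.
by rewrite mulr0 mul0r addr0.
Qed.

Lemma profileN b p t : profile b p (- t) = - profile b p t.
Proof.
rewrite /profile /profile_arg sqrrN mulrN !mulNr atanN artanhN; last first.
  exact: (profile_arg_bound b p t).
by rewrite mulrN mulNr opprD.
Qed.

Lemma is_derive_cts (f : R -> R) (x df : R) :
  is_derive x 1 f df -> {for x, continuous f}.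
Proof.
by move=> hf; apply/differentiable_continuous/derivable1_diffP; apply: ex_derive.
Qed.

Lemma mean_value (f df : R -> R) (x y : R) : x < y ->
  (forall z : R, is_derive z 1 f (df z)) ->
  exists2 z, x < z < y & f y - f x = df z * (y - x).
Proof.
move=> xy hf; have [z|z zxy ->] := MVT xy (fun z _ => hf z).
  by apply: continuous_subspaceT => w; exact: is_derive_cts (hf w).
by exists z => //; move: zxy; rewrite in_itv.
Qed.

Lemma is_derive_profile_t b p t :
  let S := Num.sqrt (1 + b ^+ 2 * (1 + p ^+ 2)) in
  let C := Num.sqrt (1 + p ^+ 2 + t ^+ 2) in
  is_derive t 1 (profile b p)
    (S / C ^+ 2 * (1 - profile_arg b p t * artanh (profile_arg b p t))).
Proof.
move=> S C; have S0 : S != 0 by rewrite gt_eqF// profile_S_gt0.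
have C0 : C != 0 by rewrite gt_eqF// profile_C_gt0.
apply: (is_derive_eq (is_derive_profile b (is_derive_cst p t 1) (is_derive_id t 1))).
rewrite /= !mulr0 mul0r subr0 add0r mulr1 -/S -/C.
by rewrite [in RHS]/profile_arg -/S -/C; field; rewrite S0 C0.
Qed.

Lemma profile_continuous_t b p : continuous (profile b p).
Proof. by move=> t; exact: is_derive_cts (is_derive_profile_t b p t). Qed.

(** On a circle the [artanh] term drops out, and what remains is k times the integrand of h_a. It
    has the sign of mu sin u, so for mu > 0 the profile also grows along the half circle from u = 0
    to u = pi. *)
Lemma is_derive_profile_circle b mu (u : R) :
  is_derive u 1 (fun u => profile b (mu * sin u) (- (mu * cos u)))
    (Num.sqrt (1 + b ^+ 2 * (1 + (mu * sin u) ^+ 2)) / (1 + (mu * sin u) ^+ 2) *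
     (mu * sin u)).
Proof.
have hmu : is_derive u 1 (fun=> mu) 0 by exact: is_derive_cst.
have hp : is_derive u 1 (fun u => mu * sin u) (mu * cos u).
  by apply: (is_derive_eq (is_deriveM_fun hmu (is_derive_sin u))); rewrite mul0r add0r.
have hc : is_derive u 1 (fun u => - (mu * cos u)) (mu * sin u).
  apply: (is_derive_eq (is_deriveN (is_deriveM_fun hmu (is_derive_cos u)))).
  by rewrite mul0r add0r mulrN opprK.
apply: (is_derive_eq (is_derive_profile b hp hc)).
set p := mu * sin u; set t := mu * cos u.
have P0 : 1 + p ^+ 2 != 0 by have := sqr_ge0 p; lra.
have C0 : 1 + p ^+ 2 + t ^+ 2 != 0 by have := sqr_ge0 p; have := sqr_ge0 t; lra.
rewrite [X in _ - _ * X](_ : _ = 0) ?mulr0 ?subr0; last by ring.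
rewrite sqrrN sqr_sqrtr; last by have := sqr_ge0 p; have := sqr_ge0 t; lra.
by field; rewrite P0 C0.
Qed.

Section Bounded.
Variables (b x0 M : R).
Hypotheses (x0_in01 : 0 < x0 < 1) (x0_root : x0 * artanh x0 = 1).
Hypotheses (M_gt0 : 0 < M)
  (M_x0 : x0 ^+ 2 * ((1 + M ^+ 2) * (1 + b ^+ 2)) = M ^+ 2).

(** [M_x0] says that q = x0 at (p, t) = (0, M). With rho^2 = p^2 + t^2, one has q^2 <= rho^2 / ((1 +
    rho^2) (1 + b^2)), and this bound increases with rho up to x0^2 at rho = M. *)
Lemma profile_arg_lt p t : p ^+ 2 + t ^+ 2 < M ^+ 2 -> `|profile_arg b p t| < x0.
Proof.
move=> ptM; have [x00 x01] := andP x0_in01.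
rewrite -(@ltr_pXn2r _ 2) ?nnegrE// ?(ltW x00)// -normrX ger0_norm ?sqr_ge0//.
rewrite profile_arg_sqr.
have hp := sqr_ge0 p; have ht := sqr_ge0 t; have hb := sqr_ge0 b.
have hbp := mulr_ge0 hb hp.
have h1 : 0 < (1 + p ^+ 2 + t ^+ 2) * (1 + b ^+ 2 * (1 + p ^+ 2)).
  by rewrite mulr_gt0 ?profile_N_gt0//; lra.
rewrite ltr_pdivrMr//; have hM := sqr_ge0 M.
rewrite -(@ltr_pM2r _ ((1 + M ^+ 2) * (1 + b ^+ 2))); last by nra.
rewrite [ltRHS]mulrAC M_x0.
apply: (@le_lt_trans _ _ ((p ^+ 2 + t ^+ 2) * (1 + M ^+ 2) * (1 + b ^+ 2))).
  by rewrite mulrA !ler_pM2r; lra.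
apply: (@lt_le_trans _ _ (M ^+ 2 * (1 + p ^+ 2 + t ^+ 2) * (1 + b ^+ 2))).
  rewrite ltr_pM2r; last lra.
  by nra.
rewrite -mulrA ler_pM2l; last by rewrite exprn_gt0.
by rewrite ler_pM2l; nra.
Qed.

Lemma profile_arg0_gt mu : M < mu -> x0 < profile_arg b 0 mu.
Proof.
move=> Mmu; have [x00 x01] := andP x0_in01; have mu0 := lt_trans M_gt0 Mmu.
have q0 : 0 <= profile_arg b 0 mu.
  by rewrite /profile_arg divr_ge0 ?mulr_ge0 ?sqrtr_ge0// ltW.
rewrite -(@ltr_pXn2r _ 2) ?nnegrE ?(ltW x00)// profile_arg_sqr.
rewrite expr0n/= !addr0 mulr1; have hb := sqr_ge0 b; have hmu := sqr_ge0 mu.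
have hM := sqr_ge0 M.
rewrite ltr_pdivlMr; last by nra.
rewrite -(@ltr_pM2r _ ((1 + M ^+ 2) * (1 + b ^+ 2))); last by nra.
rewrite [ltLHS]mulrAC M_x0 !mulrA ltr_pM2r; last lra.
have : M ^+ 2 < mu ^+ 2 by rewrite ltr_pXn2r// nnegrE ltW.
by nra.
Qed.

Lemma profile_lt p t1 t2 : t1 < t2 ->
  p ^+ 2 + t1 ^+ 2 <= M ^+ 2 -> p ^+ 2 + t2 ^+ 2 <= M ^+ 2 ->
  profile b p t1 < profile b p t2.
Proof.
move=> t12 h1 h2.
have [t /andP[t1t tt2] e] := mean_value t12 (is_derive_profile_t b p).
rewrite -subr_gt0 e pmulr_lgt0 ?subr_gt0//.
rewrite mulr_gt0 ?divr_gt0 ?exprn_gt0 ?profile_S_gt0 ?profile_C_gt0//.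
rewrite subr_gt0; apply: (mul_artanh_lt1 x0_in01 x0_root).
(* An intermediate t has t^2 < max(t1^2, t2^2), hence lies strictly inside the disc even when the
   endpoints are on its boundary. *)
by apply: profile_arg_lt; have [t0|t0] := lerP 0 t; nra.
Qed.

Lemma profile_inj p t1 t2 :
  p ^+ 2 + t1 ^+ 2 <= M ^+ 2 -> p ^+ 2 + t2 ^+ 2 <= M ^+ 2 ->
  profile b p t1 = profile b p t2 -> t1 = t2.
Proof.
move=> h1 h2 e; case: (ltgtP t1 t2) => // t12.
- by have := profile_lt t12 h1 h2; rewrite e ltxx.
- by have := profile_lt t12 h2 h1; rewrite e ltxx.
Qed.

(** On the axis p = 0 the argument q grows with t and passes x0 at t = M, so the profile increases
    up to M and does not increase beyond. *)
Lemma profile0_max mu : 0 < mu -> profile b 0 mu <= profile b 0 M.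
Proof.
move=> mu0; have [muM|Mmu|->//] := ltgtP mu M.
  by apply/ltW/profile_lt => //; rewrite expr0n/= add0r//; nra.
have [t /andP[Mt tmu] e] := mean_value Mmu (is_derive_profile_t b 0).
rewrite -subr_le0 e pmulr_lle0 ?subr_gt0//.
rewrite mulr_ge0_le0 ?divr_ge0 ?exprn_ge0 ?sqrtr_ge0//.
rewrite subr_le0 ltW//; apply: (mul_artanh_gt1 x0_in01 x0_root).
by rewrite profile_arg0_gt//; case/andP: (profile_arg_bound b 0 t).
Qed.

(** Moving along the circle through (p, t) up to its top (0, mu), on the side where sin u >= 0, the
    profile does not decrease. *)
Lemma profile_le_radius p t : profile b p t <= profile b 0 (Num.sqrt (p ^+ 2 + t ^+ 2)).
Proof.
set mu := Num.sqrt _.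
have mu2 : mu ^+ 2 = p ^+ 2 + t ^+ 2 by rewrite sqr_sqrtr ?addr_ge0 ?sqr_ge0.
have [mu0|mu0] := eqVneq mu 0.
  have : p ^+ 2 + t ^+ 2 == 0 by rewrite -mu2 mu0 expr0n.
  rewrite paddr_eq0 ?sqr_ge0// !sqrf_eq0 => /andP[_ /eqP->].
  by rewrite mu0 !profile0.
have {}mu0 : 0 < mu by rewrite lt_neqAle eq_sym mu0 sqrtr_ge0.
have tmu : -1 <= - t / mu <= 1.
  by rewrite ler_pdivrMr// ler_pdivlMr//; have := sqr_ge0 p; nra.
(* This angle in [0, pi] recovers t exactly but p only up to sign, which is enough because the
   profile depends on p through p^2. *)
pose u := acos (- t / mu).
have cu : - (mu * cos u) = t.
  rewrite /u acosK ?in_itv//= mulrC divfK ?opprK//; exact: lt0r_neq0.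
have su : (mu * sin u) ^+ 2 = p ^+ 2.
  have : (mu * cos u) ^+ 2 + (mu * sin u) ^+ 2 = mu ^+ 2.
    by rewrite !exprMn -mulrDr cos2Dsin2 mulr1.
  by rewrite -sqrrN cu mu2; lra.
have -> : profile b p t = profile b (mu * sin u) (- (mu * cos u)).
  by rewrite cu /profile /profile_arg su.
have -> : profile b 0 mu = profile b (mu * sin pi) (- (mu * cos pi)).
  by rewrite sinpi cospi mulr0 mulrN1 opprK.
have u0 := acos_ge0 tmu; have := acos_lepi tmu.
rewrite -/u le_eqVlt => /predU1P[->//|upi].
have [v /andP[uv vpi] e] := mean_value upi (is_derive_profile_circle b mu).
rewrite -subr_ge0 e pmulr_lge0 ?subr_gt0//.
rewrite mulr_ge0 ?divr_ge0 ?sqrtr_ge0//; first by rewrite addr_ge0// sqr_ge0.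
by rewrite mulr_ge0 ?(ltW mu0)// ltW// sin_gt0_pi// vpi (le_lt_trans u0).
Qed.

(** The top of the circle through (p, t) lies strictly below that of the circle of radius M. Stating
    [lt_M] for any s with s^2 = t^2 treats t and - t together, and oddness in t gives the lower
    bound. *)
Lemma profile_lt_height p t :
  p ^+ 2 + t ^+ 2 < M ^+ 2 -> `|profile b p t| < profile b 0 M.
Proof.
move=> ptM; have lt_M s : s ^+ 2 = t ^+ 2 -> profile b p s < profile b 0 M.
  move=> st; apply: (le_lt_trans (profile_le_radius p s)); rewrite st.
  have s2 : Num.sqrt (p ^+ 2 + t ^+ 2) ^+ 2 = p ^+ 2 + t ^+ 2.
    by rewrite sqr_sqrtr ?addr_ge0 ?sqr_ge0.
  have : Num.sqrt (p ^+ 2 + t ^+ 2) < M.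
    by rewrite -(@ltr_pXn2r _ 2) ?nnegrE ?sqrtr_ge0 ?(ltW M_gt0)// s2.
  by move=> /profile_lt; apply; rewrite expr0n/= add0r// s2 ltW.
by rewrite ltr_norml ltrNl -profileN !lt_M// sqrrN.
Qed.

End Bounded.
End ProfileMonotonicity.

(** * Closed forms for the radius and the height of a tube *)

Section TubeFormulas.
Context {R : realType}.
Variable kappa : R.
Hypothesis kappa_gt0 : 0 < kappa.
Let k := Num.sqrt kappa.

Let k_gt0 : 0 < k. Proof. by rewrite sqrtr_gt0. Qed.
Let k_neq0 : k != 0. Proof. exact: lt0r_neq0. Qed.
Let k_sqr : k ^+ 2 = kappa. Proof. exact/sqr_sqrtr/ltW. Qed.

(** The inverse of r |-> - cot (k r) from (0, pi / k) onto the line. *)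
Definition radius_of (p : R) : R := (pi / 2 + atan p) / Num.sqrt kappa.

Let mul_radius_of p : k * radius_of p = pi / 2 + atan p.
Proof. by rewrite /radius_of mulrC divfK. Qed.

Lemma radius_of_bound p : 0 < radius_of p < pi / k.
Proof.
rewrite divr_gt0//=; last by have := atan_gtNpi2 p; lra.
by rewrite ltr_pM2r ?invr_gt0//; have := atan_ltpi2 p; lra.
Qed.

Lemma sn_radius_of p : sn kappa (radius_of p) = (k * Num.sqrt (1 + p ^+ 2))^-1.
Proof.
rewrite /sn -/k mul_radius_of addrC sinDpihalf cos_atan.
by rewrite invfM mulrC.
Qed.

Lemma cs_radius_of p : cs kappa (radius_of p) = - p / Num.sqrt (1 + p ^+ 2).
Proof.
have c0 : cos (atan p) != 0.
  by rewrite gt_eqF// cos_gt0_pihalf// atan_gtNpi2 atan_ltpi2.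
rewrite /cs -/k mul_radius_of addrC cosDpihalf mulNr -cos_atan.
by rewrite -[X in X * _]atanK /tan divfK.
Qed.

Lemma sn_gt0 r : 0 < r < pi / k -> 0 < sn kappa r.
Proof.
move=> /andP[r0 rpi]; rewrite /sn divr_gt0//= sin_gt0_pi// mulr_gt0//=.
by rewrite mulrC -ltr_pdivlMr.
Qed.

Lemma radius_ofK r : 0 < r < pi / k ->
  radius_of (- (cs kappa r / (k * sn kappa r))) = r.
Proof.
move=> r_bnd; have [r0 rpi] := andP r_bnd.
have s0 : sin (k * r) != 0.
  by have := sn_gt0 r_bnd; rewrite /sn pmulr_lgt0 ?invr_gt0// => /lt0r_neq0.
have -> : - (cs kappa r / (k * sn kappa r)) = tan (k * r - pi / 2).
  by rewrite /cs /sn /tan sinBpihalf cosBpihalf -/k mulNr; field; rewrite k_neq0 s0.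
rewrite /radius_of tanK; last first.
  have : k * r < pi by rewrite mulrC -ltr_pdivlMr.
  by have := mulr_gt0 k_gt0 r0; rewrite in_itv/=; lra.
by rewrite addrC subrK mulrC mulKf.
Qed.

Section Tube.
Variable H : R.
Hypothesis H_gt0 : 0 < H.
Let mu := k / (2 * H).

(** Since J = - 2 H / kappa, the constants cancel and the equation becomes (2 H / kappa) cs r = - sn
    r sin sigma; dividing by sn r > 0 determines the cotangent, hence r. *)
Lemma tube_radiusE sigma : tube_radius kappa H sigma = radius_of (mu * sin sigma).
Proof.
have H0 : H != 0 by exact: lt0r_neq0.
apply: get_unique.
  split; first exact: radius_of_bound.
  rewrite sn_radius_of cs_radius_of /tube_energy /mu; set p := k / _ * _.
  have D0 : Num.sqrt (1 + p ^+ 2) != 0.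
    by rewrite gt_eqF// sqrtr_gt0; have := sqr_ge0 p; lra.
  rewrite /p; move: (Num.sqrt _) D0 => D D0; rewrite -k_sqr.
  by field; rewrite D0 k_neq0 H0.
move=> r [r_bnd e]; rewrite -[LHS](radius_ofK r_bnd); congr radius_of.
have s0 : sn kappa r != 0 by rewrite gt_eqF// sn_gt0.
have ek : 2 * H / kappa = 2 * H / k ^+ 2 by rewrite k_sqr.
move: e; rewrite /tube_energy /mu ek => e.
have {e} : cs kappa r = - (k ^+ 2 / (2 * H) * (sn kappa r * sin sigma)).
  apply: (@mulfI _ (2 * H / k ^+ 2)).
    by rewrite mulf_neq0 ?invr_neq0 ?expf_neq0 ?mulf_neq0.
  rewrite [RHS](_ : _ = - (sn kappa r * sin sigma)).
    move: (2 * H / k ^+ 2) e => c e; lra.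
  by field; rewrite H0.
by move=> ->; field; rewrite s0 k_neq0 H0.
Qed.

(** After substitution of the radius, the integrand is the derivative of [profile / k] along the
    circle u |-> (mu sin u, - mu cos u). This primitive vanishes at the base point u = pi / 2, where
    t = 0. *)
Lemma tube_hE a sigma : tube_h kappa a H sigma =
  profile (k * a) (mu * sin sigma) (- (mu * cos sigma)) / k.
Proof.
have H0 : H != 0 by exact: lt0r_neq0.
have mu0 : mu != 0 by rewrite mulf_neq0// invr_neq0// mulf_neq0.
pose b := k * a.
pose f u := Num.sqrt (1 + b ^+ 2 * (1 + (mu * sin u) ^+ 2)) /
  (1 + (mu * sin u) ^+ 2) * (mu * sin u) / k.
pose F u := profile b (mu * sin u) (- (mu * cos u)) / k.
have dF (u : R) : is_derive u 1 F (f u).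
  have h := is_deriveM_fun (is_derive_profile_circle b mu u)
    (is_derive_cst (k^-1 : R) u 1).
  by apply: (is_derive_eq h); rewrite mulr0 addr0.
have cf : continuous f.
  move=> u; have hcst (c : R) : is_derive u 1 (fun=> c) 0 by exact: is_derive_cst.
  have hp := is_deriveM_fun (hcst mu) (is_derive_sin u).
  have hP := is_deriveD_fun (hcst 1) (is_derive_sqr hp).
  have hN := is_deriveD_fun (hcst 1) (is_deriveM_fun (hcst (b ^+ 2)) hP).
  have hS := is_derive_comp hN (is_derive1_sqrt (profile_N_gt0 b (mu * sin u))).
  have P0 : 1 + (mu * sin u) ^+ 2 != 0 by have := sqr_ge0 (mu * sin u); lra.
  have h := is_deriveM_fun (is_deriveM_fun (is_derive_div hS hP P0) hp) (hcst k^-1).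
  exact: is_derive_cts h.
rewrite /tube_h [X in oriented_integral X](_ : _ = f); last first.
  apply/funext => u; rewrite tube_radiusE sn_radius_of cs_radius_of /f.
  set p := mu * sin u.
  have D2 : Num.sqrt (1 + p ^+ 2) ^+ 2 = 1 + p ^+ 2.
    by rewrite sqr_sqrtr//; have := sqr_ge0 p; lra.
  have D0 : 0 < Num.sqrt (1 + p ^+ 2).
    by rewrite sqrtr_gt0; have := sqr_ge0 p; lra.
  have P0 : 1 + p ^+ 2 != 0 by have := sqr_ge0 p; lra.
  move: (Num.sqrt (1 + p ^+ 2)) D2 D0 => D D2 D0.
  rewrite (_ : (k * D)^-1 ^+ 2 + a ^+ 2 =
      (1 + b ^+ 2 * (1 + p ^+ 2)) * (k * D)^-1 ^+ 2); last first.
    by rewrite -D2 /b; field; rewrite k_neq0 lt0r_neq0.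
  rewrite sqrtrM ?(ltW (profile_N_gt0 _ _))// sqrtr_sqr ger0_norm; last first.
    by rewrite invr_ge0 mulr_ge0// ltW.
  (* As 2 H / k = 1 / mu and sin u = p / mu, the denominator is (1 + p^2) / (mu D) with D^2 = 1 +
     p^2. *)
  rewrite (_ : 2 * H / (k * D) - - p / D * sin u = D / mu); last first.
    rewrite -[D in RHS](mulfK (lt0r_neq0 D0)) -expr2 D2 /p /mu; field.
    by rewrite k_neq0 H0 lt0r_neq0.
  rewrite /p -D2; field.
  by rewrite k_neq0 lt0r_neq0.
have F0 : F (pi / 2) = 0.
  by rewrite /F cos_pihalf mulr0 oppr0 profile0 mul0r.
have FTC x y : x <= y -> Rintegral lebesgue_measure `[x, y] f = F y - F x.
  rewrite le_eqVlt => /predU1P[->|xy].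
    by rewrite set_itv1 Rintegral_set1 subrr.
  rewrite /Rintegral (@continuous_FTC2 _ f F)//.
  - exact: continuous_subspaceT.
  - split.
    + by move=> u _; apply: ex_derive.
    + by apply: cvg_at_right_filter; exact: is_derive_cts (dF x).
    + by apply: cvg_at_left_filter; exact: is_derive_cts (dF y).
  - by move=> u _; rewrite derive1E derive_val.
rewrite /oriented_integral; case: ifPn => [le_s|].
  by rewrite FTC// F0 subr0.
by rewrite -ltNge => /ltW le_s; rewrite FTC// F0 sub0r opprK.
Qed.

Lemma tube_heightE a : tube_height kappa a H = profile (k * a) 0 mu / k.
Proof.
by rewrite /tube_height tube_hE sinpi cospi mulr0 mulrN1 opprK.
Qed.

End Tube.
End TubeFormulas.

(** * Coordinates and charts *)

Section Coordinates.
Context {R : realType}.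
Implicit Types (r theta z : R) (x v : 'rV[R]_3).

Definition coord3 x i : R := x 0 (inord i).

Lemma coord3_point0 r theta z : coord3 (point3 r theta z) 0 = r.
Proof. by rewrite /coord3 mxE inordK. Qed.
Lemma coord3_point1 r theta z : coord3 (point3 r theta z) 1 = theta.
Proof. by rewrite /coord3 mxE inordK. Qed.
Lemma coord3_point2 r theta z : coord3 (point3 r theta z) 2 = z.
Proof. by rewrite /coord3 mxE inordK. Qed.
Definition coord3_point := (coord3_point0, coord3_point1, coord3_point2).

Lemma ord3_cases (i : 'I_3) : [\/ i = inord 0, i = inord 1 | i = inord 2].
Proof.
by case: i => [[|[|[|//]]] ?]; [apply: Or31|apply: Or32|apply: Or33];
  apply: val_inj; rewrite /= inordK.
Qed.

Lemma coord3K x : point3 (coord3 x 0) (coord3 x 1) (coord3 x 2) = x.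
Proof.
by apply/rowP => j; case: (ord3_cases j) => ->; rewrite mxE inordK.
Qed.

Lemma ord_max3 : ord_max = inord 2 :> 'I_3.
Proof. by apply: val_inj; rewrite /= inordK. Qed.

Lemma coord3_line x v (s : R) i : coord3 (s *: v + x) i = s * coord3 v i + coord3 x i.
Proof. by rewrite /coord3 !mxE. Qed.

Lemma cubeP x : cube x <->
  [/\ `|coord3 x 0| < 1, `|coord3 x 1| < 1 & `|coord3 x 2| < 1].
Proof.
split=> [h|[h0 h1 h2] i]; first by split; exact: h.
by case: (ord3_cases i) => ->.
Qed.

Lemma open_cube : open (@cube R).
Proof.
rewrite openE => x cx; apply/nbhs_ballP => /=.
pose e := Num.min (1 - `|coord3 x 0|) (Num.min (1 - `|coord3 x 1|) (1 - `|coord3 x 2|)).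
have [h0 h1 h2] := (cubeP x).1 cx.
exists e; first by rewrite /= !lt_min !subr_gt0 h0 h1.
move=> y [e0 xy]; apply/cubeP.
have hy i : `|coord3 x i - coord3 y i| < e by exact: xy.
have aux i : e <= 1 - `|coord3 x i| -> `|coord3 y i| < 1.
  move=> ei; have := ler_normB (coord3 x i) (coord3 x i - coord3 y i).
  by have := hy i; rewrite subKr; lra.
by split; apply: aux; rewrite !ge_min lexx ?orbT.
Qed.

Lemma elementary_coord3 (D : set 'rV[R]_3) i : elementary D (fun x => coord3 x i).
Proof. exact: elementary_coord. Qed.

Lemma elementary_map_point3 m (D : set 'rV[R]_m) (r theta z : 'rV[R]_m -> R) :
  elementary D r -> elementary D theta -> elementary D z ->
  elementary_map D (fun q => point3 (r q) (theta q) (z q)).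
Proof.
move=> hr ht hz j.
by case: (ord3_cases j) => ->; under eq_fun do rewrite mxE inordK//=.
Qed.

End Coordinates.

(** * Relative openness, directional derivatives and connectedness *)

Section GeneralLemmas.
Context {R : realType}.

(** An explicit inverse [g] on an open set takes the place of the inverse function theorem: the
    image is the trace on [X] of the open set of points of [O] that [g] sends into [V]. *)
Lemma relatively_open_image m n (X O : set 'rV[R]_n) (V : set 'rV[R]_m)
    (f : 'rV[R]_m -> 'rV[R]_n) (g : 'rV[R]_n -> 'rV[R]_m) :
  open O -> elementary_map O g -> open V ->
  (forall y, V y -> [/\ X (f y), O (f y) & g (f y) = y]) ->
  (forall q, X q -> O q -> f (g q) = q) ->
  relatively_open X (f @` V).
Proof.
move=> oO eg oV fV fg; exists (O `&` g @^-1` V).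
  exact: elementary_preimage_open.
apply/seteqP; split=> [_ [y Vy <-]|q [Xq [Oq Vgq]]].
  by have [Xfy Ofy gfy] := fV _ Vy; split=> //; split=> //; rewrite /preimage/= gfy.
by exists (g q) => //; exact: fg.
Qed.

Lemma relatively_open_cover n (X U : set 'rV[R]_n) :
  (forall p, U p -> exists W, [/\ relatively_open X W, W p & W `<=` U]) ->
  relatively_open X U.
Proof.
move=> h; exists (\bigcup_(V in [set V | open V /\ X `&` V `<=` U]) V).
  by apply: bigcup_open => V [].
apply/seteqP; split=> [p Up|p [Xp [V [_ XV] Vp]]]; last exact: XV.
have [_ [[V oV ->] [Xp Vp] VU]] := h p Up.
by split=> //; exists V.
Qed.

(** Reduces directional derivatives to the one-variable rules proved for [profile]. *)
Lemma derive_line m (f : 'rV[R]_m -> R) x v l :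
  is_derive (0 : R) 1 (fun s : R => f (s *: v + x)) l -> 'D_v f x = l.
Proof.
move=> [_ <-]; rewrite /derive; set g1 := fun h : R => h^-1 *: _.
set g2 := fun h : R => h^-1 *: _; suff -> : g1 = g2 by [].
apply/funext => h; rewrite /g1 /g2 /= /shift /=.
by rewrite addr0 scale0r add0r [_%:A]mulr1.
Qed.

(** The range is a union of images of lines through the origin, all of which contain [f 0]. *)
Lemma connected_rV n (f : 'rV[R]_3 -> 'rV[R]_n) :
  continuous f -> connected (range f).
Proof.
move=> cf; have -> : range f = \bigcup_(v in setT) range (fun s : R => f (s *: v)).
  apply/seteqP; split=> [_ [v _ <-]|_ [v _ [s _ <-]]]; last by exists (s *: v).
  by exists v => //; exists 1 => //; rewrite scale1r.
apply: bigcup_connected; first by exists (f 0) => v _; exists 0 => //; rewrite scale0r.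
move=> v _; apply: connected_continuous_connected.
  by apply/connected_intervalP => x y _ _ z _.
apply: continuous_subspaceT => s.
apply: (@continuous_comp _ _ _ (fun s : R => s *: v) f); last exact: cf.
exact: scalel_continuous.
Qed.

End GeneralLemmas.

(** * Local branches of the polar angle *)

Section Polar.
Context {R : realType}.
Implicit Types (x y rho t : R).

(** The plane is first rotated by - t0, which centres the branch of [atan] at the direction t0; the
    formula is the angle of (x, y) on the open half plane facing that direction. *)
Definition polar_angle t0 x y : R :=
  t0 + atan ((y * cos t0 - x * sin t0) / (x * cos t0 + y * sin t0)).

(** Charts have angular half-width 1, which therefore fits inside the branch of [atan]. *)
Lemma pihalf_gt1 : 1 < pi / 2 :> R.
Proof.
rewrite lt_neqAle pihalf_ge1 andbT; apply/eqP => h.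
by have := @cos1_gt0 R; rewrite h cos_pihalf ltxx.
Qed.

Lemma polar_angleK t0 rho t : 0 < rho -> `|t - t0| < 1 ->
  0 < rho * cos t * cos t0 + rho * sin t * sin t0 /\
  polar_angle t0 (rho * cos t) (rho * sin t) = t.
Proof.
move=> rho0; rewrite ltr_norml => /andP[t1 t2]; have pi1 := pihalf_gt1.
have c0 : 0 < cos (t - t0) by apply: cos_gt0_pihalf; lra.
have -> : rho * cos t * cos t0 + rho * sin t * sin t0 = rho * cos (t - t0).
  by rewrite cosB; ring.
split; first exact: mulr_gt0.
rewrite /polar_angle.
rewrite (_ : rho * cos t * cos t0 + rho * sin t * sin t0 = rho * cos (t - t0));
  last by rewrite cosB; ring.
rewrite (_ : rho * sin t * cos t0 - rho * cos t * sin t0 = rho * sin (t - t0));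
  last by rewrite sinB; ring.
rewrite -mulf_div divff ?lt0r_neq0// mul1r -[sin _ / _]/(tan _).
rewrite tanK; first by rewrite addrC subrK.
by rewrite in_itv/=; lra.
Qed.

Lemma polar_angle_spec t0 x y : 0 < x * cos t0 + y * sin t0 ->
  0 < Num.sqrt (x ^+ 2 + y ^+ 2) /\
  Num.sqrt (x ^+ 2 + y ^+ 2) * cos (polar_angle t0 x y) = x /\
  Num.sqrt (x ^+ 2 + y ^+ 2) * sin (polar_angle t0 x y) = y.
Proof.
rewrite /polar_angle; set X := x * _ + _; set Y := y * _ - _ => X0.
have XY : x ^+ 2 + y ^+ 2 = X ^+ 2 + Y ^+ 2.
  transitivity ((x ^+ 2 + y ^+ 2) * (cos t0 ^+ 2 + sin t0 ^+ 2)).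
    by rewrite cos2Dsin2 mulr1.
  by rewrite /X /Y; ring.
have rho0 : 0 < X ^+ 2 + Y ^+ 2 by rewrite ltr_pwDl ?sqr_ge0 ?exprn_gt0.
rewrite XY; set rho := Num.sqrt _.
have {}rho0 : 0 < rho by rewrite sqrtr_gt0.
have cA : cos (atan (Y / X)) = X / rho.
  rewrite cos_atan (_ : 1 + _ = (X ^+ 2 + Y ^+ 2) * X^-1 ^+ 2); last first.
    by field; exact: lt0r_neq0.
  rewrite sqrtrM ?addr_ge0 ?sqr_ge0// sqrtr_sqr gtr0_norm ?invr_gt0//.
  by rewrite invfM invrK mulrC.
have cA0 : cos (atan (Y / X)) != 0 by rewrite cA mulf_neq0 ?invr_neq0 ?lt0r_neq0.
have sA : sin (atan (Y / X)) = Y / rho.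
  rewrite -[LHS](divfK cA0) -[sin _ / _]/(tan _) atanK cA.
  by field; rewrite !lt0r_neq0.
split=> //; rewrite cosD sinD cA sA.
have hx : x = X * cos t0 - Y * sin t0.
  transitivity (x * (cos t0 ^+ 2 + sin t0 ^+ 2)); first by rewrite cos2Dsin2 mulr1.
  by rewrite /X /Y; ring.
have hy : y = X * sin t0 + Y * cos t0.
  transitivity (y * (cos t0 ^+ 2 + sin t0 ^+ 2)); first by rewrite cos2Dsin2 mulr1.
  by rewrite /X /Y; ring.
by split; [rewrite [RHS]hx|rewrite [RHS]hy]; field; exact: lt0r_neq0.
Qed.

Lemma elementary_polar_angle m (D : set 'rV[R]_m) t0 (x y : 'rV[R]_m -> R) :
  (forall q, D q -> 0 < x q * cos t0 + y q * sin t0) ->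
  elementary D x -> elementary D y ->
  elementary D (fun q => polar_angle t0 (x q) (y q)).
Proof.
move=> h ex ey; apply: elementaryD; first exact: elementary_cst.
have cst c := @elementary_cst R m D c.
apply/elementary_atan/elementary_div => [q /h /lt0r_neq0//||].
  by apply: elementaryB; exact: elementaryM.
by apply: elementaryD; exact: elementaryM.
Qed.

End Polar.

Section ElementaryOpen.
Context {R : realType} {m : nat}.

Lemma elementary_continuous (f : 'rV[R]_m -> R) : elementary setT f -> continuous f.
Proof.
move=> ef x; have [df _] := elementary_derive openT ef.
exact/differentiable_continuous/df.
Qed.

Lemma open_gt0 (f : 'rV[R]_m -> R) : elementary setT f -> open [set x | 0 < f x].
Proof.
move=> ef; apply: (@open_comp _ _ f [set y | 0 < y]); last exact: open_gt.
by move=> x _; exact: elementary_continuous.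
Qed.

Lemma elementary_profile b (D : set 'rV[R]_m) (p t : 'rV[R]_m -> R) :
  elementary D p -> elementary D t -> elementary D (fun x => profile b (p x) (t x)).
Proof.
move=> ep et; have cst c := @elementary_cst R m D c.
have eP : elementary D (fun x => 1 + p x ^+ 2).
  by apply: elementaryD => //; exact: elementaryX.
have eS : elementary D (fun x => Num.sqrt (1 + b ^+ 2 * (1 + p x ^+ 2))).
  apply: elementary_sqrt => [x _|]; first exact: profile_N_gt0.
  by apply: elementaryD => //; exact: elementaryM.
have eC : elementary D (fun x => Num.sqrt (1 + p x ^+ 2 + t x ^+ 2)).
  apply: elementary_sqrt => [x _|]; first by rewrite -sqrtr_gt0 profile_C_gt0.
  by apply: elementaryD => //; exact: elementaryX.
have S0 x : Num.sqrt (1 + b ^+ 2 * (1 + p x ^+ 2)) != 0.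
  by rewrite gt_eqF// profile_S_gt0.
have C0 x : Num.sqrt (1 + p x ^+ 2 + t x ^+ 2) != 0.
  by rewrite gt_eqF// profile_C_gt0.
apply: elementaryD.
  apply: elementaryM => //; apply/elementary_atan/elementary_div => //.
  exact: elementaryM.
apply: elementary_div => //; apply: elementary_artanh => [x _|].
  exact: profile_arg_bound.
by apply: elementary_div => [x _||]; [rewrite mulf_neq0|exact: et|exact: elementaryM].
Qed.

End ElementaryOpen.

(** * Foliated charts in the coordinates (p, theta, z) *)

Section Foliation.
Context {R : realType}.
Variables (k a b x0 M : R).
Hypotheses (k_gt0 : 0 < k) (M_gt0 : 0 < M).
Hypotheses (x0_in01 : 0 < x0 < 1) (x0_root : x0 * artanh x0 = 1)
  (M_x0 : x0 ^+ 2 * ((1 + M ^+ 2) * (1 + b ^+ 2)) = M ^+ 2).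

(** The one factor of the charts that has no explicit inverse: it turns t into z and leaves p and
    theta alone. *)
Definition shear (y : 'rV[R]_3) : 'rV[R]_3 :=
  point3 (coord3 y 0) (coord3 y 1)
    (profile b (coord3 y 0) (coord3 y 2) / k + a * coord3 y 1).

(** Openness comes from the intermediate value theorem in t, with p and theta as parameters: strict
    inequalities at the two ends of a short t-interval persist for nearby target points. *)
Lemma shear_open (V : set 'rV[R]_3) : open V ->
  (forall y, V y -> coord3 y 0 ^+ 2 + coord3 y 2 ^+ 2 < M ^+ 2) ->
  open (shear @` V).
Proof.
move=> oV VM; rewrite openE => _ [y Vy <-].
have [e /= e0 eV] : exists2 e, 0 < e & forall p th t, `|coord3 y 0 - p| < e ->
    `|coord3 y 1 - th| < e -> `|coord3 y 2 - t| < e -> V (point3 p th t).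
  move: oV; rewrite openE => /(_ _ Vy)/nbhs_ballP[e /= e0 eV].
  exists e => // p th t h0 h1 h2; apply: eV; split=> // i j.
  rewrite ord1; case: (ord3_cases j) => -> /=;
    by rewrite [X in ball _ _ X]mxE inordK.
pose p1 := coord3 y 0; pose th1 := coord3 y 1; pose t1 := coord3 y 2.
(* Half of e, so that the closed interval [t1 - e2, t1 + e2] stays within distance e of t1. *)
pose e2 := e / 2; have e20 : 0 < e2 by rewrite divr_gt0.
have e2e : e2 < e by rewrite /e2; lra.
have V0 u : `|u| < e -> V (point3 p1 th1 (t1 + u)).
  by move=> ue; apply: eV; rewrite ?subrr ?normr0// opprD addrA subrr sub0r normrN.
have f_lt u v : `|u| < e -> `|v| < e -> u < v ->
    profile b p1 (t1 + u) < profile b p1 (t1 + v).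
  move=> ue ve uv; have := VM _ (V0 _ ue); have := VM _ (V0 _ ve).
  rewrite !coord3_point => hv hu.
  by apply: (profile_lt x0_in01 x0_root M_gt0 M_x0); rewrite ?ltrD2l// ltW.
(* [h u q] compares the last coordinate of q with the one [shear] would produce from t = t1 + u over
   the same p and theta. It is negative for u = e2 and positive for u = - e2, at [shear y] and hence
   near it. *)
pose h u (q : 'rV[R]_3) :=
  coord3 q 2 - (profile b (coord3 q 0) (t1 + u) / k + a * coord3 q 1).
have ch u : continuous (h u).
  apply: elementary_continuous.
  have cst c := @elementary_cst R 3 setT c; have crd i := @elementary_coord3 R setT i.
  apply: elementaryB => //; apply: elementaryD; last exact: elementaryM.
  by apply: elementaryM => //; exact: elementary_profile.
have cc i : continuous (fun q : 'rV[R]_3 => coord3 q i).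
  exact/elementary_continuous/elementary_coord3.
have h_lt : h e2 (shear y) < 0.
  rewrite /h !coord3_point -/p1 -/th1 -/t1 opprD addrACA subrr addr0 subr_lt0.
  rewrite ltr_pM2r ?invr_gt0//.
  by have := @f_lt 0 e2; rewrite addr0; apply; rewrite ?normr0 ?gtr0_norm.
have h_gt : 0 < h (- e2) (shear y).
  rewrite /h !coord3_point -/p1 -/th1 -/t1 opprD addrACA subrr addr0 subr_gt0.
  rewrite ltr_pM2r ?invr_gt0//.
  have := @f_lt (- e2) 0; rewrite addr0; apply; rewrite ?normr0 ?normrN ?gtr0_norm//.
  by rewrite oppr_lt0.
have np : \forall q \near shear y, `|p1 - coord3 q 0| < e.
  have /cvgrPdist_lt/(_ _ e0) := cc 0%N (shear y).
  by rewrite /shear !coord3_point.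
have nth : \forall q \near shear y, `|th1 - coord3 q 1| < e.
  have /cvgrPdist_lt/(_ _ e0) := cc 1%N (shear y).
  by rewrite /shear !coord3_point.
have nlt : \forall q \near shear y, h e2 q < 0.
  by apply: (cvgr_lt _ (ch e2 (shear y))).
have ngt : \forall q \near shear y, 0 < h (- e2) q.
  by apply: (cvgr_gt _ (ch (- e2) (shear y))).
near=> q.
have qlt : h e2 q < 0 by near: q.
have qgt : 0 < h (- e2) q by near: q.
have qp : `|p1 - coord3 q 0| < e by near: q.
have qth : `|th1 - coord3 q 1| < e by near: q.
(* The value that the profile has to take at the sought t. *)
pose v := k * (coord3 q 2 - a * coord3 q 1).
have v1 : profile b (coord3 q 0) (t1 - e2) < v.
  by move: qgt; rewrite /h /v opprD [- _ + - _]addrC addrA subr_gt0 ltr_pdivrMr// mulrC.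
have v2 : v < profile b (coord3 q 0) (t1 + e2).
  by move: qlt; rewrite /h /v opprD [- _ + - _]addrC addrA subr_lt0 ltr_pdivlMr// mulrC.
have [|||t tI ft] := @IVT _ (profile b (coord3 q 0)) (t1 - e2) (t1 + e2) v.
- by lra.
- by apply: continuous_subspaceT; exact: profile_continuous_t.
- by rewrite (min_idPl _) ?(max_idPr _) ?(ltW v1) ?(ltW v2)// ltW// (lt_trans v1 v2).
exists (point3 (coord3 q 0) (coord3 q 1) t).
  apply: eV => //; rewrite -/t1 ltr_norml; move: tI; rewrite in_itv/=; lra.
rewrite /shear !coord3_point ft /v -[RHS]coord3K; congr point3.
by field; exact: lt0r_neq0.
Unshelve. all: by end_near. Qed.

Lemma shear_inj y z : coord3 y 0 ^+ 2 + coord3 y 2 ^+ 2 < M ^+ 2 ->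
  coord3 z 0 ^+ 2 + coord3 z 2 ^+ 2 < M ^+ 2 -> shear y = shear z -> y = z.
Proof.
move=> dy dz e; have e1 := congr1 (coord3^~ 0%N) e.
have e2 := congr1 (coord3^~ 1%N) e; have := congr1 (coord3^~ 2%N) e.
move: e1 e2; rewrite /shear !coord3_point => e1 e2; rewrite e1 e2 => /addIr.
move=> /(mulIf (invr_neq0 (lt0r_neq0 k_gt0))) e3.
rewrite -[LHS]coord3K -[RHS]coord3K e1 e2; congr point3.
by apply: (profile_inj x0_in01 x0_root M_gt0 M_x0 _ _ e3); rewrite -?e1 ltW// e1.
Qed.

Section PolarChart.
Variables (th0 s0 m e : R).

(** The cube coordinates are theta, the angle sigma and the radius mu, centred at (th0, s0, m). The
    radius comes last because plaques fix the last coordinate, and it alone is rescaled, to stay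
    within (0, M). *)
Definition polar_map (x : 'rV[R]_3) : 'rV[R]_3 :=
  point3 ((m + e * coord3 x 2) * sin (s0 + coord3 x 1)) (th0 + coord3 x 0)
    (- ((m + e * coord3 x 2) * cos (s0 + coord3 x 1))).

(** Here (- t, p) = mu (cos sigma, sin sigma), so the polar coordinates are those of (- t, p). *)
Definition polar_inv (y : 'rV[R]_3) : 'rV[R]_3 :=
  point3 (coord3 y 1 - th0) (polar_angle s0 (- coord3 y 2) (coord3 y 0) - s0)
    ((Num.sqrt ((- coord3 y 2) ^+ 2 + coord3 y 0 ^+ 2) - m) / e).

Definition half_plane : set 'rV[R]_3 :=
  [set y | 0 < - coord3 y 2 * cos s0 + coord3 y 0 * sin s0].

Lemma open_half_plane : open half_plane.
Proof.
have cst c := @elementary_cst R 3 setT c; have crd i := @elementary_coord3 R setT i.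
by apply: open_gt0; apply: elementaryD; apply: elementaryM => //; exact: elementaryN.
Qed.

Lemma elementary_polar_map : elementary_map setT polar_map.
Proof.
have cst c := @elementary_cst R 3 setT c; have crd i := @elementary_coord3 R setT i.
have em : elementary setT (fun x : 'rV[R]_3 => m + e * coord3 x 2).
  by apply: elementaryD => //; exact: elementaryM.
have es : elementary setT (fun x : 'rV[R]_3 => s0 + coord3 x 1) by exact: elementaryD.
apply: elementary_map_point3.
- by apply: elementaryM => //; exact: elementary_sin.
- exact: elementaryD.
- by apply/elementaryN/elementaryM => //; exact: elementary_cos.
Qed.

Lemma elementary_polar_inv : elementary_map half_plane polar_inv.
Proof.
have cst c := @elementary_cst R 3 half_plane c.
have crd i := @elementary_coord3 R half_plane i.
have c2 := elementaryN (crd 2%N).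
apply: elementary_map_point3.
- exact: elementaryB.
- by apply: elementaryB => //; exact: elementary_polar_angle.
- apply: elementaryM => //; apply: elementaryB => //.
  apply: elementary_sqrt => [y /polar_angle_spec[]|]; first by rewrite sqrtr_gt0.
  by apply: elementaryD; exact: elementaryX.
Qed.

Hypotheses (e_gt0 : 0 < e) (em : e <= m) (emM : m + e <= M).

Lemma polar_radius_bound x : cube x -> 0 < m + e * coord3 x 2 < M.
Proof.
move=> /cubeP[_ _]; rewrite ltr_norml => /andP[h1 h2].
have := ltr_pM2l e_gt0 (-1) (coord3 x 2); have := ltr_pM2l e_gt0 (coord3 x 2) 1.
rewrite h1 h2 => h3 h4; have := em; have := emM; lra.
Qed.

Lemma polar_mapK x : cube x -> half_plane (polar_map x) /\ polar_inv (polar_map x) = x.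
Proof.
move=> cx; have [mu0 muM] := andP (polar_radius_bound cx).
have [h0 h1 h2] := (cubeP x).1 cx.
have hs : `|s0 + coord3 x 1 - s0| < 1 by rewrite addrAC subrr add0r.
have [h3 h4] := polar_angleK mu0 hs.
rewrite /half_plane /polar_inv/= !coord3_point opprK; split=> //.
rewrite h4 (addrAC th0) subrr add0r (addrAC s0) subrr add0r -[RHS]coord3K.
congr point3; rewrite !exprMn -mulrDr cos2Dsin2 mulr1 sqrtr_sqr gtr0_norm//.
by field; exact: lt0r_neq0.
Qed.

Lemma polar_invK y : half_plane y -> polar_map (polar_inv y) = y.
Proof.
move=> /polar_angle_spec[_ [hx hy]]; rewrite /polar_map /polar_inv !coord3_point.
rewrite (addrC th0) subrK (addrC s0) subrK -[RHS]coord3K.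
rewrite (mulrC e) divfK ?lt0r_neq0// (addrC m) subrK.
by rewrite hx hy opprK.
Qed.

Lemma polar_map_disc x : cube x ->
  coord3 (polar_map x) 0 ^+ 2 + coord3 (polar_map x) 2 ^+ 2 < M ^+ 2.
Proof.
move=> /polar_radius_bound/andP[mu0 muM]; rewrite !coord3_point sqrrN !exprMn.
by rewrite addrC -mulrDr cos2Dsin2 mulr1 ltr_pXn2r// nnegrE ltW.
Qed.

Lemma polar_open (D : set 'rV[R]_3) : open D -> D `<=` @cube R ->
  open (polar_map @` D).
Proof.
move=> oD Dc; have [||V oV ->] := relatively_open_image (X := setT) (f := polar_map)
  open_half_plane elementary_polar_inv oD _ _.
- by move=> x /Dc /polar_mapK[].
- by move=> y _; exact: polar_invK.
- by rewrite setTI.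
Qed.

Definition shear_polar x := shear (polar_map x).

Lemma shear_polar_open (D : set 'rV[R]_3) : open D -> D `<=` @cube R ->
  open (shear_polar @` D).
Proof.
move=> oD Dc; rewrite /shear_polar -image_comp.
apply: shear_open; first exact: polar_open.
by move=> _ [x /Dc cx <-]; exact: polar_map_disc.
Qed.

Lemma shear_polar_inj : set_inj (@cube R) shear_polar.
Proof.
move=> x y /set_mem cx /set_mem cy /shear_inj e0.
have [_ hx] := polar_mapK cx; have [_ hy] := polar_mapK cy.
by rewrite -hx -hy e0//; exact: polar_map_disc.
Qed.

Lemma elementary_shear_polar : elementary_map setT shear_polar.
Proof.
have cst c := @elementary_cst R 3 setT c.
have ep i : elementary setT (fun x => coord3 (polar_map x) i).
  exact: elementary_polar_map.
apply: elementary_map_point3 => //.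
by apply: elementaryD; apply: elementaryM => //; exact: elementary_profile.
Qed.

(* Along the line through [x] directed by [v], a vanishing derivative of [p]
   leaves the derivative of [profile b p t] a positive multiple of that of
   [t]. *)
Lemma shear_polar_immersion x v : cube x ->
  (forall i, 'D_v (fun y => coord3 (shear_polar y) i) x = 0) -> v = 0.
Proof.
move=> cx hD; have [mu0 muM] := andP (polar_radius_bound cx).
have disc := polar_map_disc cx.
pose mu := m + e * coord3 x 2; pose s := s0 + coord3 x 1.
have hc (c : R) : is_derive (0 : R) 1 (fun=> c) 0 by exact: is_derive_cst.
have hid (i : nat) (c d : R) : is_derive (0 : R) 1
    (fun u : R => c + d * coord3 (u *: v + x) i) (d * coord3 v i).
  have -> : (fun u : R => c + d * coord3 (u *: v + x) i) =
      (fun u => (c + d * coord3 x i) + u * (d * coord3 v i)).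
    by apply/funext => u; rewrite coord3_line; ring.
  have h := is_deriveM_fun (is_derive_id (0 : R) 1) (hc (d * coord3 v i)).
  apply: (is_derive_eq (is_deriveD_fun (hc (c + d * coord3 x i)) h)).
  by rewrite /= mul1r mulr0 addr0 add0r.
have hmu := hid 2%N m e; have hs := hid 1%N s0 1; rewrite mul1r in hs.
have {}hs : is_derive (0 : R) 1 (fun u : R => s0 + coord3 (u *: v + x) 1) (coord3 v 1).
  by move: hs; under eq_fun do rewrite mul1r.
have x_at i : coord3 (0 *: v + x) i = coord3 x i by rewrite scale0r add0r.
pose p (u : R) :=
  (m + e * coord3 (u *: v + x) 2) * sin (s0 + coord3 (u *: v + x) 1).
pose t (u : R) :=
  - ((m + e * coord3 (u *: v + x) 2) * cos (s0 + coord3 (u *: v + x) 1)).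
pose dp := e * coord3 v 2 * sin s + mu * (cos s * coord3 v 1).
pose dt := - (e * coord3 v 2 * cos s + mu * (- sin s * coord3 v 1)).
have hp : is_derive (0 : R) 1 p dp.
  apply: (is_derive_eq (is_deriveM_fun hmu (is_derive_comp hs (is_derive_sin _)))).
  by rewrite !x_at.
have ht : is_derive (0 : R) 1 t dt.
  apply: (is_derive_eq (is_deriveN (is_deriveM_fun hmu
    (is_derive_comp hs (is_derive_cos _))))).
  by rewrite !x_at.
have pt_disc : p 0 ^+ 2 + t 0 ^+ 2 < M ^+ 2.
  by move: disc; rewrite !coord3_point /p /t !x_at.
have hth : is_derive (0 : R) 1 (fun u : R => th0 + coord3 (u *: v + x) 0) (coord3 v 0).
  by have := hid 0%N th0 1; under eq_fun do rewrite mul1r; rewrite mul1r.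
have v0 : coord3 v 0 = 0.
  rewrite -(hD 1%N); under eq_fun do rewrite /shear_polar /shear !coord3_point.
  by symmetry; apply: derive_line.
have dp0 : dp = 0.
  rewrite -(hD 0%N); under eq_fun do rewrite /shear_polar /shear !coord3_point.
  by symmetry; apply: derive_line.
have dt0 : dt = 0.
  have hz := is_deriveD_fun (is_deriveM_fun (is_derive_profile b hp ht) (hc k^-1))
    (is_deriveM_fun (hc a) hth).
  have := hD 2%N; under eq_fun do rewrite /shear_polar /shear !coord3_point.
  rewrite (derive_line (f := fun y => profile b _ _ / k + a * _) hz).
  rewrite dp0 v0 !mulr0 !mul0r !addr0 subr0 add0r.
  set S := Num.sqrt (1 + b ^+ 2 * _); set C := Num.sqrt (1 + _ + _).
  have S_gt0 : 0 < S by exact: profile_S_gt0.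
  have C_gt0 : 0 < C by exact: profile_C_gt0.
  have q_lt := mul_artanh_lt1 x0_in01 x0_root
    (profile_arg_lt x0_in01 M_gt0 M_x0 pt_disc).
  set L := artanh _ in q_lt *.
  rewrite (_ : _ * k^-1 = dt * (S / C ^+ 2 * (1 - profile_arg b (p 0) (t 0) * L) / k)).
    move=> /eqP; rewrite mulf_eq0 => /orP[/eqP//|].
    by rewrite gt_eqF// !(mulr_gt0, invr_gt0, exprn_gt0)// subr_gt0.
  by rewrite /profile_arg -/S -/C; field; rewrite !lt0r_neq0.
(* The pair (dp, dt) is a rotation of (e v_2, mu v_1); rotating back shows that v_1 and v_2
   vanish. *)
have ev : e * coord3 v 2 = sin s * dp - cos s * dt.
  transitivity (e * coord3 v 2 * (cos s ^+ 2 + sin s ^+ 2)).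
    by rewrite cos2Dsin2 mulr1.
  by rewrite /dp /dt; ring.
have mv : mu * coord3 v 1 = cos s * dp + sin s * dt.
  transitivity (mu * coord3 v 1 * (cos s ^+ 2 + sin s ^+ 2)).
    by rewrite cos2Dsin2 mulr1.
  by rewrite /dp /dt; ring.
have v1 : coord3 v 1 = 0.
  by apply: (mulfI (lt0r_neq0 mu0)); rewrite mv dp0 dt0 !mulr0 addr0.
have v2 : coord3 v 2 = 0.
  by apply: (mulfI (lt0r_neq0 e_gt0)); rewrite ev dp0 dt0 !mulr0 subr0.
apply/rowP => i; rewrite mxE.
by case: (ord3_cases i) => ->; [exact: v0|exact: v1|exact: v2].
Qed.

End PolarChart.
End Foliation.

(** * The foliation in an abstract ambient space *)

Section LeafFoliation.
Context {R : realType} {n : nat}.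
Variables (k a b x0 H0 : R).
Hypotheses (k_gt0 : 0 < k) (H0_gt0 : 0 < H0).
Let M := k / (2 * H0).
Hypotheses (x0_in01 : 0 < x0 < 1) (x0_root : x0 * artanh x0 = 1)
  (M_x0 : x0 ^+ 2 * ((1 + M ^+ 2) * (1 + b ^+ 2)) = M ^+ 2).

Variables (X : set 'rV[R]_n) (Om : R -> R -> R -> 'rV[R]_n).
Variables (g : R -> 'rV[R]_n -> 'rV[R]_3) (O : R -> set 'rV[R]_n).
Hypotheses (Om_X : forall p th z, X (Om p th z))
  (Om_elementary : forall p th z : 'rV[R]_3 -> R,
    elementary setT p -> elementary setT th -> elementary setT z ->
    elementary_map setT (fun x => Om (p x) (th x) (z x)))
  (O_open : forall th0, open (O th0))
  (g_elementary : forall th0, elementary_map (O th0) (g th0))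
  (OmK : forall th0 p th z, `|th - th0| < 1 ->
    O th0 (Om p th z) /\ g th0 (Om p th z) = point3 p th z)
  (gK : forall th0 q, X q -> O th0 q ->
    Om (coord3 (g th0 q) 0) (coord3 (g th0 q) 1) (coord3 (g th0 q) 2) = q).

Let height p t th := profile b p t / k + a * th.

Hypothesis Om_separated : forall p t th p' t' th',
  p ^+ 2 + t ^+ 2 < M ^+ 2 -> p' ^+ 2 + t' ^+ 2 < M ^+ 2 ->
  Om p th (height p t th) = Om p' th' (height p' t' th') -> p = p' /\ t = t'.

(** The ambient space enters only through [Om], a parametrization by (p, theta, z) with an
    elementary inverse [g th0] on an open set [O th0] for each window |theta - th0| < 1. This covers
    both the universal cover and the sphere times a line, where theta is determined only modulo 2
    pi. Global disjointness is the content of [Om_separated]. *)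
Definition leaf_param (mu s th : R) : 'rV[R]_n :=
  Om (mu * sin s) th (profile b (mu * sin s) (- (mu * cos s)) / k + a * th).

Definition leaf mu : set 'rV[R]_n := [set q | exists s th, q = leaf_param mu s th].

Let Om3 (y : 'rV[R]_3) := Om (coord3 y 0) (coord3 y 1) (coord3 y 2).

Definition leaf_chart th0 s0 m e (x : 'rV[R]_3) : 'rV[R]_n :=
  leaf_param (m + e * coord3 x 2) (s0 + coord3 x 1) (th0 + coord3 x 0).

Lemma leaf_chartE th0 s0 m e x :
  leaf_chart th0 s0 m e x = Om3 (shear_polar k a b th0 s0 m e x).
Proof. by rewrite /Om3 /shear_polar /shear !coord3_point. Qed.

Lemma elementary_leaf_chart th0 s0 m e : elementary_map setT (leaf_chart th0 s0 m e).
Proof.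
have ep i : elementary setT (fun x => coord3 (shear_polar k a b th0 s0 m e x) i).
  exact: elementary_shear_polar.
rewrite (_ : leaf_chart _ _ _ _ = fun x => Om3 (shear_polar k a b th0 s0 m e x)).
  by apply: Om_elementary; exact: ep.
by apply/funext => x; exact: leaf_chartE.
Qed.

Let M_gt0 : 0 < M. Proof. by rewrite divr_gt0// mulr_gt0. Qed.

Section Chart.
Variables (th0 s0 m e : R).
Hypotheses (e_gt0 : 0 < e) (em : e <= m) (emM : m + e <= M).
Let psi := leaf_chart th0 s0 m e.
Let core := shear_polar k a b th0 s0 m e.

Lemma leaf_chartK x : cube x -> O th0 (psi x) /\ g th0 (psi x) = core x.
Proof.
move=> /cubeP[h0 _ _]; rewrite /psi leaf_chartE.
have [|h1 h2] := @OmK th0 (coord3 (core x) 0) (coord3 (core x) 1) (coord3 (core x) 2).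
  by rewrite !coord3_point addrAC subrr add0r.
by split=> //; rewrite h2 coord3K.
Qed.

Lemma leaf_chart_parametrization : parametrization X psi.
Proof.
have dpsi x : differentiable psi x.
  exact: elementary_map_differentiable openT (elementary_leaf_chart th0 s0 m e) I.
split.
- apply: elementary_map_smooth; first exact: open_cube.
  move=> j; apply: (@elementaryS _ _ setT) => //; exact: elementary_leaf_chart.
- move=> x cx; apply: row_free_jacobian => // v dv0.
  apply: (shear_polar_immersion k_gt0 M_gt0 x0_in01 x0_root M_x0 e_gt0 em emM cx
    (th0 := th0) (s0 := s0) (a := a)).
  (* A vector killed by the differential of [psi] is killed by that of [g th0 \o psi], which is
     [core] on the cube, and [core] is an immersion there. *)
  move=> i; have [Ox gx] := leaf_chartK cx.
  have dg := elementary_map_differentiable (@O_open th0) (@g_elementary th0) Ox.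
  have dgpsi : differentiable (g th0 \o psi) x by exact: differentiable_comp.
  rewrite (_ : 'D_v _ x = 'D_v (fun y => coord3 ((g th0 \o psi) y) i) x).
    rewrite derive_rV// (diff_comp (dpsi x) dg) /= dv0.
    by rewrite linear0 mxE.
  apply: near_eq_derive; have := open_nbhs_nbhs (conj (@open_cube R) cx).
  by apply: filterS => y /leaf_chartK[_ /= ->].
- move=> x y cx cy exy.
  apply: (shear_polar_inj k_gt0 M_gt0 x0_in01 x0_root M_x0 e_gt0 em emM
    (th0 := th0) (s0 := s0) (a := a) cx cy).
  have [_ hx] := leaf_chartK (set_mem cx); have [_ hy] := leaf_chartK (set_mem cy).
  by rewrite -/core -hx -hy exy.
- move=> D oD Dc; have -> : psi @` D = Om3 @` (core @` D).
    rewrite image_comp; congr image; apply/funext => x; exact: leaf_chartE.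
  apply: (relatively_open_image (@O_open th0) (@g_elementary th0)).
  + exact: (shear_polar_open k_gt0 M_gt0 x0_in01 x0_root M_x0 e_gt0 em emM oD Dc).
  + move=> _ [x Dx <-]; have [h1 h2] := leaf_chartK (Dc _ Dx).
    by rewrite /core -leaf_chartE; split=> //; exact: Om_X.
  + by move=> q Xq Oq; exact: gK.
Qed.

Lemma leaf_chart_center : (psi @` @cube R) (leaf_param m s0 th0).
Proof.
exists 0; first by move=> i; rewrite mxE normr0.
by rewrite /psi /leaf_chart /coord3 !mxE mulr0 !addr0.
Qed.

(** [Om_separated] recovers (p, t), and mu is its distance to the origin. *)
Lemma leaf_param_inj (mu s th mu' s' th' : R) : 0 < mu < M -> 0 < mu' < M ->
  leaf_param mu s th = leaf_param mu' s' th' -> mu = mu'.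
Proof.
move=> /andP[mu0 muM] /andP[mu'0 mu'M].
have disc (u v : R) : 0 < u -> u < M ->
    (u * sin v) ^+ 2 + (- (u * cos v)) ^+ 2 < M ^+ 2.
  move=> u0 uM; rewrite sqrrN addrC !(exprMn _ u) -mulrDr cos2Dsin2 mulr1.
  by rewrite ltr_pXn2r// nnegrE ltW.
move=> /Om_separated[||e1 e2]; [exact: disc|exact: disc|].
apply/eqP; rewrite -(@eqrXn2 _ 2) ?ltW//; apply/eqP.
have rad (u v : R) : u ^+ 2 = (u * cos v) ^+ 2 + (u * sin v) ^+ 2.
  by rewrite !(exprMn _ u) -mulrDr cos2Dsin2 mulr1.
by rewrite (rad mu s) (rad mu' s') e1 (oppr_inj e2).
Qed.

(** Since a point determines its mu, a leaf meets the chart only where the radius equals mu, that is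
    in a single plaque. If the chart does not reach mu, both sides are empty. *)
Lemma leaf_chart_plaque mu : 0 < mu < M ->
  leaf mu `&` (psi @` @cube R) = plaque psi ((mu - m) / e).
Proof.
move=> muM; apply/seteqP; split=> [q [[s [th ->]] [x cx]]|_ [x [cx x2] <-]].
  move=> xq; exists x => //; split=> //.
  have := polar_radius_bound e_gt0 em emM cx.
  move=> /leaf_param_inj/(_ muM xq) <-.
  by rewrite ord_max3 addrAC subrr add0r mulrC mulKf// lt0r_neq0.
split; last by exists x.
exists (s0 + coord3 x 1), (th0 + coord3 x 0); rewrite /psi /leaf_chart.
rewrite (_ : m + e * coord3 x 2 = mu)//; rewrite /coord3 -ord_max3 x2.
by field; exact: lt0r_neq0.
Qed.

End Chart.

Lemma index_bound H : H0 < H -> 0 < k / (2 * H) < M.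
Proof.
move=> HH; have H_gt0 := lt_trans H0_gt0 HH.
rewrite divr_gt0 ?mulr_gt0//= /M ltr_pM2l// ltf_pV2 ?posrE ?mulr_gt0//.
by rewrite ltr_pM2l.
Qed.

(** The map H |-> k / (2 H) is an involution exchanging (H0, +oo) and (0, M). *)
Lemma index_of mu : 0 < mu < M -> H0 < k / (2 * mu) /\ k / (2 * (k / (2 * mu))) = mu.
Proof.
move=> /andP[mu0 muM]; split; last by field; rewrite !lt0r_neq0.
move: muM; rewrite /M !ltr_pdivlMr ?mulr_gt0//; lra.
Qed.

Lemma chart_scale mu : 0 < mu < M -> exists e, [/\ 0 < e, e <= mu & mu + e <= M].
Proof.
move=> /andP[mu0 muM]; exists (Num.min mu (M - mu)); split.
- by rewrite lt_min mu0 subr_gt0.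
- by rewrite ge_min lexx.
- by rewrite addrC -lerBrDr ge_min lexx orbT.
Qed.

(** Every clause is read off a chart centred at the given point: its image is open in [X] and made
    of leaves, its own leaf is the plaque at 0, and each other leaf is one plaque at most, so
    singletons serve as the countable sets. *)
Theorem leaves_foliate :
  foliates_open_subset X [set H | H0 < H] (fun H => leaf (k / (2 * H))).
Proof.
have leaf_X mu : leaf mu `<=` X by move=> _ [s [th ->]]; exact: Om_X.
have charts H s th : H0 < H -> exists psi : 'rV[R]_3 -> 'rV[R]_n,
    [/\ parametrization X psi, (psi @` @cube R) (leaf_param (k / (2 * H)) s th),
      psi @` @cube R `<=` \bigcup_(H in [set H | H0 < H]) leaf (k / (2 * H)),
      leaf (k / (2 * H)) `&` (psi @` @cube R) = plaque psi 0 &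
      forall H', H0 < H' -> exists t,
        leaf (k / (2 * H')) `&` (psi @` @cube R) = plaque psi t].
  move=> /index_bound muM; set mu := k / (2 * H).
  have [e [e_gt0 em emM]] := chart_scale muM.
  exists (leaf_chart th s mu e); split.
  - exact: leaf_chart_parametrization.
  - exact: leaf_chart_center.
  - move=> _ [x cx <-].
    have [h1 h2] := index_of (polar_radius_bound e_gt0 em emM cx).
    by eexists; first exact: h1; rewrite h2; eexists; eexists.
  - by rewrite leaf_chart_plaque// subrr mul0r.
  - move=> H' /index_bound mu'M; exists ((k / (2 * H') - mu) / e).
    exact: leaf_chart_plaque.
split.
- apply: relatively_open_cover => p [H HH [s [th ->]]].
  have [psi [[_ _ _ oi] psip psiU _ _]] := charts H s th HH.
  exists (psi @` @cube R); split=> //; apply: oi => //; exact: open_cube.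
- move=> H H' /index_bound HM /index_bound HM' [_ [[s [th ->]] [s' [th']]]].
  move=> /(leaf_param_inj HM HM') e; move: (HM) (HM').
  move=> /andP[mu0 _] /andP[mu'0 _].
  move: e => /(mulfI (lt0r_neq0 k_gt0))/invr_inj; apply: mulfI.
  exact: lt0r_neq0.
- move=> H HH; have [psi0 _] := charts H 0 0 HH; split.
  + by exists (leaf_param (k / (2 * H)) 0 0); exists 0, 0.
  (* With scale e = 0 the radius is frozen, so the chart formula on all of R^3 sweeps out exactly
     one leaf. *)
  + have -> : leaf (k / (2 * H)) = range (leaf_chart 0 0 (k / (2 * H)) 0).
      apply/seteqP; split=> [_ [s [th ->]]|_ [x _ <-]].
        exists (point3 th s 0) => //.
        by rewrite /leaf_chart !coord3_point mulr0 addr0 !add0r.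
      by exists (0 + coord3 x 1), (0 + coord3 x 0); rewrite /leaf_chart mul0r addr0.
    apply: connected_rV => x.
    exact: elementary_map_continuous openT (elementary_leaf_chart _ _ _ _) I.
  + split=> // _ [s [th ->]]; have [psi [h1 h2 _ h3 _]] := charts H s th HH.
    by exists psi.
- move=> _ [H HH [s [th ->]]]; have [psi [h1 h2 h3 _ h4]] := charts H s th HH.
  exists psi; split=> // H' /h4[t ht]; exists [set t]; first exact: countable1.
  by rewrite ht bigcup_set1.
Qed.

End LeafFoliation.

(** * The universal cover and the sphere times a line *)

Lemma foliates_open_subset_ext (R : realType) n (X : set 'rV[R]_n) (T : Type)
    (I : set T) (L L' : T -> set 'rV[R]_n) :
  (forall i, I i -> L i = L' i) ->
  foliates_open_subset X I L' -> foliates_open_subset X I L.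
Proof.
move=> LL' [h1 h2 h3 h4]; have UU : \bigcup_(i in I) L i = \bigcup_(i in I) L' i.
  exact: eq_bigcupr.
split.
- by rewrite UU.
- by move=> i j Ii Ij; rewrite !LL'//; exact: h2.
- by move=> i Ii; rewrite LL'//; exact: h3.
- move=> p; rewrite UU => /h4[psi [k1 k2 k3 k4]]; exists psi; split=> //.
  by move=> i Ii; rewrite LL'//; exact: k4.
Qed.

(** By the half-angle formula cos d = 1 - 2 sin^2 (d / 2), where the sine is positive for 0 < |d| /
    2 < pi. *)
Lemma cos_eq1_small (R : realType) (d : R) : cos d = 1 -> `|d| < pi *+ 2 -> d = 0.
Proof.
rewrite -cos_norm => cd d_lt; apply/normr0_eq0/eqP.
rewrite eq_le normr_ge0 andbT leNgt; apply/negP => d0.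
have : 0 < sin (`|d| / 2).
  by apply: sin_gt0_pi; rewrite divr_gt0//= ltr_pdivrMr// mulr_natr.
have : cos `|d| = cos (`|d| / 2) ^+ 2 - sin (`|d| / 2) ^+ 2.
  by rewrite [in LHS](splitr `|d|) cosD !expr2.
rewrite cd; have := cos2Dsin2 (`|d| / 2); nra.
Qed.

(** * Parametrizations of the two ambient spaces and their inverses *)

Section Charts.
Context {R : realType}.
Variable kappa : R.
Hypothesis kappa_gt0 : 0 < kappa.
Let k := Num.sqrt kappa.
Let k_gt0 : 0 < k. Proof. by rewrite sqrtr_gt0. Qed.
Let k_neq0 : k != 0. Proof. exact: lt0r_neq0. Qed.
Let k_sqr : k ^+ 2 = kappa. Proof. exact/sqr_sqrtr/ltW. Qed.

Lemma radius_of_cot p :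
  - (cs kappa (radius_of kappa p) / (k * sn kappa (radius_of kappa p))) = p.
Proof.
rewrite cs_radius_of// sn_radius_of//.
have D0 : Num.sqrt (1 + p ^+ 2) != 0.
  by rewrite gt_eqF// sqrtr_gt0; have := sqr_ge0 p; lra.
by rewrite -/k; field; rewrite D0 k_neq0.
Qed.

Lemma elementary_radius_of m (D : set 'rV[R]_m) (p : 'rV[R]_m -> R) :
  elementary D p -> elementary D (fun x => radius_of kappa (p x)).
Proof.
move=> ep; have cst c := @elementary_cst R m D c.
by apply: elementaryM => //; apply: elementaryD => //; exact: elementary_atan.
Qed.

Lemma elementary_sn m (D : set 'rV[R]_m) (r : 'rV[R]_m -> R) :
  elementary D r -> elementary D (fun x => sn kappa (r x)).
Proof.
move=> er; have cst c := @elementary_cst R m D c.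
by apply: elementaryM => //; apply: elementary_sin; exact: elementaryM.
Qed.

Lemma elementary_cs m (D : set 'rV[R]_m) (r : 'rV[R]_m -> R) :
  elementary D r -> elementary D (fun x => cs kappa (r x)).
Proof.
move=> er; have cst c := @elementary_cst R m D c.
by apply: elementary_cos; exact: elementaryM.
Qed.

Definition cover_param p th z : 'rV[R]_3 := point3 (radius_of kappa p) th z.

Definition cover_inv (q : 'rV[R]_3) : 'rV[R]_3 :=
  point3 (- (cs kappa (coord3 q 0) / (k * sn kappa (coord3 q 0))))
    (coord3 q 1) (coord3 q 2).

Lemma open_universal_cover : open (universal_cover kappa).
Proof.
rewrite (_ : universal_cover kappa = [set q | 0 < coord3 q 0] `&`
    [set q | 0 < pi / k - coord3 q 0]).
  have cst c := @elementary_cst R 3 setT c; have crd i := @elementary_coord3 R setT i.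
  by apply: openI; apply: open_gt0 => //; exact: elementaryB.
apply/seteqP; split=> q; rewrite /universal_cover /coord3/= subr_gt0.
  by move=> /andP.
by move=> [-> ->].
Qed.

Lemma elementary_cover_inv : elementary_map (universal_cover kappa) cover_inv.
Proof.
have cst c := @elementary_cst R 3 (universal_cover kappa) c.
have crd i := @elementary_coord3 R (universal_cover kappa) i.
apply: elementary_map_point3 => //; apply: elementaryN.
apply: elementary_div => [q /(sn_gt0 kappa_gt0) s0||].
- by rewrite mulf_neq0// lt0r_neq0.
- exact: elementary_cs.
- by apply: elementaryM => //; exact: elementary_sn.
Qed.

Definition sphere_param p th z : 'rV[R]_4 := covering_map kappa (cover_param p th z).

Definition coord4 (q : 'rV[R]_4) i : R := q 0 (inord i).

Lemma ord4_cases (i : 'I_4) : [\/ i = inord 0, i = inord 1, i = inord 2 | i = inord 3].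
Proof.
by case: i => [[|[|[|[|//]]]] ?]; [apply: Or41|apply: Or42|apply: Or43|apply: Or44];
  apply: val_inj; rewrite /= inordK.
Qed.

Lemma coord4_covering (q : 'rV[R]_3) : let r := coord3 q 0 in
  [/\ coord4 (covering_map kappa q) 0 = sn kappa r * cos (coord3 q 1),
      coord4 (covering_map kappa q) 1 = sn kappa r * sin (coord3 q 1),
      coord4 (covering_map kappa q) 2 = cs kappa r / k &
      coord4 (covering_map kappa q) 3 = coord3 q 2].
Proof. by move=> r; split; rewrite /coord4 mxE inordK. Qed.

Lemma coord4_sphere_param p th z : let r := radius_of kappa p in
  [/\ coord4 (sphere_param p th z) 0 = sn kappa r * cos th,
      coord4 (sphere_param p th z) 1 = sn kappa r * sin th,
      coord4 (sphere_param p th z) 2 = cs kappa r / k &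
      coord4 (sphere_param p th z) 3 = z].
Proof. by have := coord4_covering (cover_param p th z); rewrite !coord3_point. Qed.

Lemma coord4_inj q q' : (forall i, (i < 4)%N -> coord4 q i = coord4 q' i) -> q = q'.
Proof. by move=> h; apply/rowP => i; case: (ord4_cases i) => ->; exact: h. Qed.

(** On the sphere the first two coordinates have modulus sn r and the third is cs r / k, so the
    quotient is cot (k r) = - p. *)
Definition sphere_inv th0 (q : 'rV[R]_4) : 'rV[R]_3 :=
  point3 (- (coord4 q 2 / Num.sqrt (coord4 q 0 ^+ 2 + coord4 q 1 ^+ 2)))
    (polar_angle th0 (coord4 q 0) (coord4 q 1)) (coord4 q 3).

Definition sphere_sector th0 : set 'rV[R]_4 :=
  [set q | 0 < coord4 q 0 * cos th0 + coord4 q 1 * sin th0].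

Lemma open_sphere_sector th0 : open (sphere_sector th0).
Proof.
have cst c := @elementary_cst R 4 setT c.
have crd i : elementary setT (coord4^~ i) by exact: elementary_coord.
by apply: open_gt0; apply: elementaryD; exact: elementaryM.
Qed.

Lemma elementary_sphere_inv th0 : elementary_map (sphere_sector th0) (sphere_inv th0).
Proof.
have cst c := @elementary_cst R 4 (sphere_sector th0) c.
have crd i : elementary (sphere_sector th0) (coord4^~ i) by exact: elementary_coord.
have h q : sphere_sector th0 q -> 0 < Num.sqrt (coord4 q 0 ^+ 2 + coord4 q 1 ^+ 2).
  by move=> /polar_angle_spec[].
apply: elementary_map_point3 => //; last exact: elementary_polar_angle.
apply/elementaryN/elementary_div => // [q /h /lt0r_neq0//|].
apply: elementary_sqrt => [q /h|]; first by rewrite sqrtr_gt0.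
by apply: elementaryD; exact: elementaryX.
Qed.

Lemma sphere_param_in p th z : sphere_line kappa (sphere_param p th z).
Proof.
have [e0 e1 e2 _] := coord4_sphere_param p th z.
rewrite /sphere_line/= -!/(coord4 _ _) e0 e1 e2 /sn /cs -/k.
set r := k * _.
transitivity ((sin r ^+ 2 * (cos th ^+ 2 + sin th ^+ 2) + cos r ^+ 2) / k ^+ 2).
  by field.
by rewrite cos2Dsin2 mulr1 addrC cos2Dsin2 k_sqr mul1r.
Qed.

Lemma elementary_sphere_param (p th z : 'rV[R]_3 -> R) :
  elementary setT p -> elementary setT th -> elementary setT z ->
  elementary_map setT (fun x => sphere_param (p x) (th x) (z x)).
Proof.
move=> ep eth ez j; have er := elementary_radius_of ep.
have cst c := @elementary_cst R 3 setT c.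
have es := elementary_sn er; have ec := elementary_cs er.
have h x := coord4_sphere_param (p x) (th x) (z x).
case: (ord4_cases j) => ->.
- apply: (@elementary_ext _ _ _ 
    (fun x => sn kappa (radius_of kappa (p x)) * cos (th x))).
    by move=> x _; case: (h x).
  by apply: elementaryM => //; exact: elementary_cos.
- apply: (@elementary_ext _ _ _ 
    (fun x => sn kappa (radius_of kappa (p x)) * sin (th x))).
    by move=> x _; case: (h x).
  by apply: elementaryM => //; exact: elementary_sin.
- apply: (@elementary_ext _ _ _ (fun x => cs kappa (radius_of kappa (p x)) / k)).
    by move=> x _; case: (h x).
  exact: elementaryM.
- by apply: (@elementary_ext _ _ _ z) => // x _; case: (h x).
Qed.

Lemma sphere_paramK th0 p th z : `|th - th0| < 1 ->
  sphere_sector th0 (sphere_param p th z) /\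
  sphere_inv th0 (sphere_param p th z) = point3 p th z.
Proof.
move=> hth; have [e0 e1 e2 e3] := coord4_sphere_param p th z.
have s0 := sn_gt0 kappa_gt0 (radius_of_bound kappa_gt0 p).
have [h1 h2] := polar_angleK s0 hth.
rewrite /sphere_sector /sphere_inv/= e0 e1 e2 e3; split=> //.
rewrite h2 !(exprMn _ (sn _ _)) -mulrDr cos2Dsin2 mulr1 sqrtr_sqr gtr0_norm//.
congr point3; rewrite -[RHS]radius_of_cot.
by field; rewrite k_neq0 lt0r_neq0.
Qed.

Lemma sphere_invK th0 q : sphere_line kappa q -> sphere_sector th0 q ->
  sphere_param (coord3 (sphere_inv th0 q) 0) (coord3 (sphere_inv th0 q) 1)
    (coord3 (sphere_inv th0 q) 2) = q.
Proof.
rewrite /sphere_line/= -!/(coord4 _ _) => hq /polar_angle_spec[rho0 [hx hy]].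
rewrite !coord3_point; set p := - _; set th := polar_angle _ _ _ in hx hy *.
set rho := Num.sqrt _ in rho0 hx hy p *.
have [e0 e1 e2 e3] := coord4_sphere_param p th (coord4 q 3).
have rho_sqr : rho ^+ 2 + coord4 q 2 ^+ 2 = kappa^-1.
  by rewrite -hq sqr_sqrtr// addr_ge0 ?sqr_ge0.
(* By the equation of the sphere, 1 + p^2 = (rho^2 + x_2^2) / rho^2 = 1 / (kappa rho^2), where x_2
   is the third coordinate of q. *)
have D : Num.sqrt (1 + p ^+ 2) = (k * rho)^-1.
  rewrite (_ : 1 + p ^+ 2 = (k * rho)^-1 ^+ 2); last first.
    rewrite exprVn exprMn k_sqr invfM -rho_sqr /p.
    by field; exact: lt0r_neq0.
  by rewrite sqrtr_sqr gtr0_norm// invr_gt0 mulr_gt0.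
have es : sn kappa (radius_of kappa p) = rho.
  by rewrite sn_radius_of// D -/k; field; rewrite k_neq0 lt0r_neq0.
have ec : cs kappa (radius_of kappa p) = k * coord4 q 2.
  by rewrite cs_radius_of// D /p; field; rewrite k_neq0 lt0r_neq0.
apply: coord4_inj => -[|[|[|[|//]]]] _.
- by rewrite e0 es.
- by rewrite e1 es.
- by rewrite e2 ec mulrC mulKf.
- exact: e3.
Qed.

(** Positivity of sn off the poles lets the radius and the direction be separated. The angle is
    recovered only modulo 2 pi, which the equation on the cosine expresses. *)
Lemma sphere_param_eq p th z p' th' z' :
  sphere_param p th z = sphere_param p' th' z' ->
  [/\ p = p', cos (th' - th) = 1 & z = z'].
Proof.
move=> e; have [e0 e1 e2 e3] := coord4_sphere_param p th z.
have [f0 f1 f2 f3] := coord4_sphere_param p' th' z'.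
rewrite -e in f0 f1 f2 f3.
have s0 := sn_gt0 kappa_gt0 (radius_of_bound kappa_gt0 p).
have s0' := sn_gt0 kappa_gt0 (radius_of_bound kappa_gt0 p').
(* Both p and p' are replaced by their expressions in the radii, so that equality of sn and of cs is
   all that is left to prove for them. *)
move: (radius_of kappa p) (radius_of kappa p') (radius_of_cot p) (radius_of_cot p')
  e0 e1 e2 f0 f1 f2 s0 s0' => r r' <- <- e0 e1 e2 f0 f1 f2 s0 s0'.
have ss (x t : R) : x ^+ 2 = (x * cos t) ^+ 2 + (x * sin t) ^+ 2.
  by rewrite !(exprMn _ x) -mulrDr cos2Dsin2 mulr1.
have es : sn kappa r = sn kappa r'.
  apply/eqP; rewrite -(@eqrXn2 _ 2) ?ltW//; apply/eqP.
  by rewrite (ss (sn _ r) th) (ss (sn _ r') th') -e0 -e1 -f0 -f1.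
have ec : cs kappa r = cs kappa r'.
  by apply: (mulIf (invr_neq0 k_neq0)); rewrite -e2 -f2.
split; [by rewrite es ec| |by rewrite -e3 -f3].
have ce : cos th = cos th' by apply: (mulfI (lt0r_neq0 s0)); rewrite -e0 f0 es.
have se : sin th = sin th' by apply: (mulfI (lt0r_neq0 s0)); rewrite -e1 f1 es.
by rewrite cosB ce se -!expr2 cos2Dsin2.
Qed.

End Charts.

(** * Tubes as leaves, their heights and their disjointness *)

Section Assembly.
Context {R : realType}.
Variables (kappa a : R).
Hypothesis kappa_gt0 : 0 < kappa.
Let k := Num.sqrt kappa.
Let k_gt0 : 0 < k. Proof. by rewrite sqrtr_gt0. Qed.
Let k_neq0 : k != 0. Proof. exact: lt0r_neq0. Qed.

Lemma lifted_tubeE H : 0 < H ->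
  lifted_tube kappa a H = leaf k a (k * a) (cover_param kappa) (k / (2 * H)).
Proof.
move=> H_gt0; rewrite /lifted_tube /leaf /leaf_param /cover_param.
by apply/seteqP; split=> q [s [th ->]]; exists s, th;
  rewrite tube_radiusE// tube_hE.
Qed.

Lemma tubeE H : 0 < H ->
  tube kappa a H = leaf k a (k * a) (sphere_param kappa) (k / (2 * H)).
Proof.
move=> H_gt0; rewrite /tube lifted_tubeE//.
apply/seteqP; split=> [_ [_ [s [th ->]] <-]|_ [s [th ->]]]; first by exists s, th.
exists (leaf_param k a (k * a) (cover_param kappa) (k / (2 * H)) s th) => //.
by exists s, th.
Qed.

Variables (x0 H0 : R).
Hypotheses (x0_in01 : 0 < x0 < 1) (x0_root : x0 * artanh x0 = 1) (H0_gt0 : 0 < H0).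
Let M := k / (2 * H0).
Hypothesis M_x0 : x0 ^+ 2 * ((1 + M ^+ 2) * (1 + (k * a) ^+ 2)) = M ^+ 2.
Let M_gt0 : 0 < M. Proof. by rewrite divr_gt0// mulr_gt0. Qed.

Lemma tube_height_max H : 0 < H -> tube_height kappa a H <= tube_height kappa a H0.
Proof.
move=> H_gt0; rewrite !tube_heightE// ler_pM2r ?invr_gt0//.
by apply: (profile0_max x0_in01 x0_root M_gt0 M_x0); rewrite divr_gt0// mulr_gt0.
Qed.

(** On the cover theta is a global coordinate, so one inverse serves for every th0, and separation
    reduces to the injectivity of the profile in t for fixed p. *)
Lemma lifted_tubes_foliate :
  foliates_open_subset (universal_cover kappa) [set H : R | H0 < H]
    (lifted_tube kappa a).
Proof.
apply: foliates_open_subset_ext => [H HH|].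
  by apply: lifted_tubeE; exact: lt_trans HH.
apply: (leaves_foliate k_gt0 H0_gt0 x0_in01 x0_root M_x0
  (g := fun=> cover_inv kappa) (O := fun=> universal_cover kappa)).
- by move=> p th z; rewrite /universal_cover/= mxE inordK//=; exact: radius_of_bound.
- move=> p th z ep eth ez; apply: elementary_map_point3 => //.
  exact: elementary_radius_of.
- by move=> _; exact: open_universal_cover.
- by move=> _; exact: elementary_cover_inv.
- move=> th0 p th z _; split.
    by rewrite /universal_cover/= mxE inordK//=; exact: radius_of_bound.
  by rewrite /cover_inv !coord3_point radius_of_cot.
- move=> _ q _ Oq; rewrite /cover_inv !coord3_point /cover_param radius_ofK//.
  exact: coord3K.
- move=> p t th p' t' th' d d' e.
  have := congr1 (coord3^~ 0%N) e; have := congr1 (coord3^~ 1%N) e.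
  have := congr1 (coord3^~ 2%N) e; rewrite !coord3_point => e2 e1 e0.
  have pp : p = p' by rewrite -(radius_of_cot kappa_gt0 p) e0 radius_of_cot.
  split=> //; move: e2; rewrite e1 => /addIr/(mulIf (invr_neq0 k_neq0)); rewrite pp.
  by apply: (profile_inj x0_in01 x0_root M_gt0 M_x0); rewrite ltW// -pp.
Qed.

(** If two parameters give the same point, a (theta' - theta) is a difference of two heights, each
    strictly smaller in absolute value than the height at [H0]. For a <> 0 this forces |theta' -
    theta| < 2 pi, hence theta' = theta; for a = 0 the heights agree at once. Injectivity of the
    profile concludes. *)
Lemma tubes_foliate : a = 0 \/ tube_height kappa a H0 <= pi * `|a| ->
  foliates_open_subset (sphere_line kappa) [set H : R | H0 < H] (tube kappa a).
Proof.
move=> a_cond; apply: foliates_open_subset_ext => [H HH|].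
  by apply: tubeE; exact: lt_trans HH.
apply: (leaves_foliate k_gt0 H0_gt0 x0_in01 x0_root M_x0
  (g := sphere_inv) (O := sphere_sector)).
- exact: sphere_param_in.
- exact: elementary_sphere_param.
- exact: open_sphere_sector.
- exact: elementary_sphere_inv.
- exact: sphere_paramK.
- by move=> th0 q Xq Oq; exact: sphere_invK.
- move=> p t th p' t' th' d d' /(sphere_param_eq kappa_gt0)[pp cth e].
  split=> //.
  suff /(mulIf (invr_neq0 k_neq0)) :
      profile (k * a) p t / k = profile (k * a) p' t' / k.
    by rewrite pp; apply: (profile_inj x0_in01 x0_root M_gt0 M_x0); rewrite ltW// -pp.
  have [a0|a0] := eqVneq a 0.
    by move: e; rewrite a0 !mul0r !addr0.
  have th_eq : th' - th = 0.
    apply: cos_eq1_small => //; case: a_cond => [/eqP|]; first by rewrite (negbTE a0).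
    rewrite tube_heightE// -/k -/M => hM.
    have b1 := profile_lt_height x0_in01 x0_root M_gt0 M_x0 d.
    have b2 := profile_lt_height x0_in01 x0_root M_gt0 M_x0 d'.
    have a_gt0 : 0 < `|a| by rewrite normr_gt0.
    rewrite -(ltr_pM2l a_gt0) -normrM.
    have -> : a * (th' - th) = (profile (k * a) p t - profile (k * a) p' t') / k.
      by rewrite mulrBr mulrBl; lra.
    rewrite normrM (gtr0_norm (x := k^-1)) ?invr_gt0//.
    apply: (lt_le_trans (y := (profile (k * a) 0 M / k) *+ 2)).
      rewrite -mulrnAl ltr_pM2r ?invr_gt0//.
      by have := ler_normB (profile (k * a) p t) (profile (k * a) p' t'); lra.
    by rewrite mulrnAr lerMn2r /= [leRHS]mulrC.
  by move: e; rewrite (subr0_eq th_eq) => /addIr.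
Qed.

(* If the height at [H0] exceeds [pi |a|], two tubes meet over the equator
   [p = 0]: the top of one is, one turn further, the bottom of another. *)
Lemma tubes_foliate_height : trivIset [set H : R | H0 < H] (tube kappa a) ->
  a = 0 \/ tube_height kappa a H0 <= pi * `|a|.
Proof.
move=> disj; have [a0|a0] := eqVneq a 0; [by left|right].
rewrite leNgt; apply/negP; rewrite tube_heightE// -/k -/M ltr_pdivlMr//.
set h0 := profile _ _ M; set c := pi * `|a| * k => ch.
have c0 : 0 < c by rewrite !mulr_gt0 ?pi_gt0// normr_gt0.
(* On the scale of the profile, a full turn shifts heights by 2 c. This d > 0 places both c + d and
   c - d in (0, h0); they are distinct and add up to 2 c. *)
pose d := Num.min (h0 - c) c / 2.
have d0 : 0 < d by rewrite divr_gt0// lt_min subr_gt0 ch.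
have m1 : Num.min (h0 - c) c <= h0 - c by rewrite ge_min lexx.
have m2 : Num.min (h0 - c) c <= c by rewrite ge_min lexx orbT.
have d1 : c + d < h0 by rewrite /d in d0 *; lra.
have d2 : 0 < c - d by rewrite /d in d0 *; lra.
have ivt v : 0 < v < h0 -> exists t, 0 < t < M /\ profile (k * a) 0 t = v.
  move=> /andP[v0 vh]; have [|||t] := @IVT _ (profile (k * a) 0) 0 M v.
  - exact: ltW.
  - by apply: continuous_subspaceT; exact: profile_continuous_t.
  - by rewrite profile0 (min_idPl _) ?(max_idPr _) ?(ltW v0) ?(ltW vh)// ltW//
      (lt_trans v0).
  rewrite in_itv/= => /andP[t0 tM] ft; exists t; split=> //.
  rewrite !lt_neqAle t0 tM !andbT; apply/andP; split; apply/eqP => e.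
    by move: v0; rewrite -ft -e profile0 ltxx.
  by move: vh; rewrite -ft e ltxx.
have [|t1 [t1M f1]] := ivt (c + d); first by lra.
have [|t2 [t2M f2]] := ivt (c - d); first by lra.
have [i1 j1] := index_of k_gt0 H0_gt0 t1M; have [i2 j2] := index_of k_gt0 H0_gt0 t2M.
suff : k / (2 * t1) = k / (2 * t2).
  move=> e; have t12 : t1 = t2 by rewrite -j1 e j2.
  by move: f1; rewrite t12 f2; lra.
apply: disj => //; exists (sphere_param kappa 0 0 ((c + d) / k)); split.
  rewrite tubeE ?(lt_trans H0_gt0 i1)// j1; exists pi, 0.
  by rewrite /leaf_param sinpi cospi !mulr0 mulrN1 opprK addr0 f1.
(* The bottom sigma = 0 of the second tube has height - (c - d) / k; a full turn in the direction
   given by the sign of a raises it by 2 pi |a| = 2 c / k, to the top of the first. *)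
rewrite tubeE ?(lt_trans H0_gt0 i2)// j2; exists 0, (Num.sg a * (pi *+ 2)).
rewrite /leaf_param sin0 cos0 mulr0 mulr1 profileN f2.
rewrite (_ : - (c - d) / k + a * _ = (c + d) / k); last first.
  rewrite mulrA [a * _]mulrC -normrEsg /c -mulr_natr; field.
  exact: k_neq0.
apply: coord4_inj => i i4.
have [e0 e1 e2 e3] := coord4_sphere_param kappa 0 0 ((c + d) / k).
have [g0 g1 g2 g3] := coord4_sphere_param kappa 0 (Num.sg a * (pi *+ 2)) ((c + d) / k).
move: i i4 => [|[|[|[|//]]]] _.
- by rewrite e0 g0 cos_sg// cos0 cos2pi.
- by rewrite e1 g1 sin_sg sin0 sin2pi !mulr0.
- by rewrite e2 g2.
- by rewrite e3 g3.
Qed.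

End Assembly.

(** The foliation is considered in two spaces because the orbit coordinate h is single-valued on the
    cover but only defined modulo 2 pi a below it; the last clause measures exactly what this
    costs. *)
Theorem corollary5p2 (R : realType) (kappa x0 a : R)
  (kappa_gt0 : 0 < kappa)
  (x0_in01 : 0 < x0 < 1)
  (x0_root : x0 * artanh x0 = 1)
  (a_small : `|a| < Num.sqrt ((1 - x0 ^+ 2) / (x0 ^+ 2 * kappa))) :
  let H0 := critical_H kappa x0 a in
  [/\ 0 < H0 /\
        (forall H : R, 0 < H -> tube_height kappa a H <= tube_height kappa a H0),
      foliates_open_subset (universal_cover kappa) [set H : R | H0 < H]
        (lifted_tube kappa a) &
      foliates_open_subset (sphere_line kappa) [set H : R | H0 < H]
        (tube kappa a)
      <-> a = 0 \/ tube_height kappa a H0 <= pi * `|a| ].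
Proof.
move=> H0; have [x00 x01] := andP x0_in01.
have k_gt0 : 0 < Num.sqrt kappa by rewrite sqrtr_gt0.
have k_sqr : Num.sqrt kappa ^+ 2 = kappa by exact/sqr_sqrtr/ltW.
(* The bound on |a| amounts to Y < 1, which makes the radicand (1 - Y) / Y in [critical_H]
   positive. *)
pose Y := x0 ^+ 2 * (1 + kappa * a ^+ 2).
have Y_gt0 : 0 < Y.
  by rewrite mulr_gt0 ?exprn_gt0// ltr_pwDl// mulr_ge0 ?sqr_ge0// ltW.
have x0_sqr : x0 ^+ 2 < 1 by rewrite expr_lt1// ltW.
have Y_lt1 : Y < 1.
  have den : 0 < x0 ^+ 2 * kappa by rewrite mulr_gt0// exprn_gt0.
  have q0 : 0 <= (1 - x0 ^+ 2) / (x0 ^+ 2 * kappa).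
    by rewrite divr_ge0// ltW// subr_gt0.
  move: a_small; rewrite -(@ltr_pXn2r _ 2) ?nnegrE ?sqrtr_ge0// sqr_sqrtr//.
  by rewrite real_normK ?num_real// ltr_pdivlMr// /Y; lra.
have Q_gt0 : 0 < (1 - Y) / Y by rewrite divr_gt0// subr_gt0.
have H0_gt0 : 0 < H0 by rewrite !mulr_gt0 ?sqrtr_gt0// invr_gt0.
(* Here M^2 = Y / (1 - Y), so 1 + M^2 = 1 / (1 - Y), while x0^2 (1 + kappa a^2) = Y. *)
have M_x0 : let M := Num.sqrt kappa / (2 * H0) in
    x0 ^+ 2 * ((1 + M ^+ 2) * (1 + (Num.sqrt kappa * a) ^+ 2)) = M ^+ 2.
  have -> : Num.sqrt kappa / (2 * H0) = (Num.sqrt ((1 - Y) / Y))^-1.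
    rewrite /H0 /critical_H -/Y; field.
    by rewrite !lt0r_neq0// sqrtr_gt0.
  rewrite /= exprVn sqr_sqrtr ?ltW// exprMn k_sqr mulrCA -/Y; field.
  by rewrite !lt0r_neq0// subr_gt0.
split.
- by split=> // H; exact: (tube_height_max kappa_gt0 x0_in01 x0_root H0_gt0 M_x0).
- exact: (lifted_tubes_foliate kappa_gt0 x0_in01 x0_root H0_gt0 M_x0).
- split=> [[_ disj _ _]|].
    exact: (tubes_foliate_height kappa_gt0 H0_gt0 disj).
  exact: (tubes_foliate kappa_gt0 x0_in01 x0_root H0_gt0 M_x0).
Qed.
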